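(* There exists an integer $N$ such that for all integers $n \ge N$, $$\hat q(n)\le q(n)^{0.955}\quad\text{and}\quad \hat p(n)\le p(n)^{0.768}.$$
   Context: For a positive integer $n$, a partition $\Pi$ of $n$ is a writing $n=n_1+n_2+\dots+n_j$ with positive integers $1\le n_1\le n_2\le\dots\le n_j$. The partition $\Pi$ is said to represent an integer $a$ if there exist $\epsilon_1,\dots,\epsilon_j\in\{0,1\}$ such that $a=\sum_{i=1}^j\epsilon_i n_i$. The set represented by $\Pi$, denoted $\mathcal E(\Pi)$, is the set of all integers represented by $\Pi$. Notation: $p(n)$ is the number of partitions of $n$; $\hat p(n)$ is the number of distinct sets among the sets $\mathcal E(\Pi)$, where $\Pi$ runs over all $p(n)$ partitions of $n$; $q(n)$ is the number of partitions of $n$ into unequal parts (i.e. pairwise distinct summands); $\hat q(n)$ is the number of distinct sets among the sets $\mathcal E(\Pi)$, where $\Pi$ runs over the $q(n)$ partitions of $n$ into unequal parts. *)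

(* Defs.v *)
From mathcomp Require Import all_boot.

Set Implicit Arguments.
Unset Strict Implicit.
Unset Printing Implicit Defensive.

Local Open Scope nat_scope.

Definition is_partition (n : nat) (s : seq nat) : bool :=
  [&& sorted leq s, all (fun m => 0 < m) s & sumn s == n].

Definition represents (s : seq nat) (a : nat) : bool :=
  [exists eps : (size s).-tuple bool,
     a == \sum_(i < size s) tnth eps i * nth 0 s i].

(* A partition of n has at most n parts, each at most n, so that all of them
   live in the finite type of sequences of length at most n over 'I_n.+1
   (see [partitions_complete]). *)
Definition parts (n : nat) (s : n.-bseq 'I_n.+1) : seq nat :=
  [seq nat_of_ord i | i <- s].

Definition partitions (n : nat) : {set n.-bseq 'I_n.+1} :=
  [set s | is_partition n (parts s)].

Definition unequal_partitions (n : nat) : {set n.-bseq 'I_n.+1} :=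
  [set s in partitions n | uniq (parts s)].

(* The integers represented by a partition of n lie between 0 and n (see
   [represents_le]), so 'I_n.+1 loses none of them. *)
Definition represented_set (n : nat) (s : n.-bseq 'I_n.+1) : {set 'I_n.+1} :=
  [set a : 'I_n.+1 | represents (parts s) a].

Definition p (n : nat) : nat := #|partitions n|.

Definition q (n : nat) : nat := #|unequal_partitions n|.

Definition phat (n : nat) : nat :=
  #|[set represented_set s | s in partitions n]|.

Definition qhat (n : nat) : nat :=
  #|[set represented_set s | s in unequal_partitions n]|.

Lemma parts_inj (n : nat) : injective (@parts n).
Proof. by move=> s t /(inj_map val_inj) st; apply: val_inj. Qed.

Lemma partitions_complete (n : nat) (s : seq nat) :
  is_partition n s -> exists2 t, t \in partitions n & parts t = s.
Proof.
move=> sP; have /and3P[_ s_gt0 /eqP s_sum] := sP.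
have size_le : size [seq inord i : 'I_n.+1 | i <- s] <= n.
  rewrite size_map -s_sum; elim: s s_gt0 {sP s_sum} => //= x s IHs.
  by case/andP=> x_gt0 /IHs s_le; rewrite -add1n leq_add.
have s_le x : x \in s -> x <= n.
  rewrite -s_sum; elim: s {sP s_gt0 s_sum size_le} => //= y s IHs.
  rewrite inE => /predU1P[->|/IHs x_le]; first exact: leq_addr.
  exact: leq_trans x_le (leq_addl _ _).
have partsE : parts (Bseq size_le) = s.
  rewrite /parts /= -map_comp -[RHS]map_id; apply/eq_in_map => x /s_le x_le.
  by rewrite /= inordK.
by exists (Bseq size_le); rewrite // inE partsE.
Qed.

Lemma represents_le (n : nat) (s : seq nat) (a : nat) :
  is_partition n s -> represents s a -> a <= n.
Proof.
move=> /and3P[_ _ /eqP<-] /existsP[eps /eqP->].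
rewrite sumnE (big_nth 0) big_mkord; apply: leq_sum => i _.
by case: (tnth eps i); rewrite ?mul1n.
Qed.

(* Main.v *)
Require Import Defs.
From mathcomp Require Import all_boot all_order all_algebra.
From mathcomp Require Import all_classical all_reals all_analysis.
From mathcomp Require Import zify ring lra.
Import Order.TTheory GRing.Theory Num.Theory.
Import numFieldNormedType.Exports.

Set Implicit Arguments.
Unset Strict Implicit.
Unset Printing Implicit Defensive.

(** Replacing [m + m + m] by [m + 2m] does not change the represented set, so
    [phat] only sees partitions with multiplicities at most [r = 2], and [qhat]
    those with [r = 1].  Fix a short window of integers [k] around [t^-1 ln(10/3)],
    where [t] has order [n^(-1/2)].  If every [k] of the window is a sum
    [j + (k - j)] of two distinct parts in more than [M] ways, where [M] has order
    [n^(1/2)], if there are [M] distinct parts not exceeding the length of the window,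
    and if the very large parts have a small sum, then the window extends step by step
    to all of [y, n - y], where [y] is its left end: the represented set is determined
    by its elements below [y], which leaves at most [2 ^ y] sets.  The remaining
    partitions are few: in the generating function [\prod_k (1 + x^k + .. + x^(rk))]
    at [x = exp(-t)], forbidding that [j] and [k - j] be both present saves a factor
    [exp(s / t)], with [s > 0.074] for [r = 1] and [s > 0.129] for [r = 2].  With
    [Z = \sum_m m^-2] (only [3/2 <= Z <= 33/20] is used) this has to be compared with
    [q(n) = exp(2 (Z/2)^(1/2) n^(1/2) (1 + o(1)))] and
    [p(n) = exp(2 Z^(1/2) n^(1/2) (1 + o(1)))], and the exponents [0.955] and
    [0.768] are admissible because [Z/2 - s < 0.955^2 Z/2] and
    [2Z/3 - s < 0.768^2 Z]. *)

(** * Subset sums *)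

(** The pairs and the small parts compete for the same parts. [M] small parts are therefore reserved
    beforehand; they meet at most [M] of the disjoint pairs [j], [k - j], whence the demand for more
    than [M] pairs. The order [n^(1/2)] of [M], with a small constant, balances two needs: a factor
    [exp(8 * M)], lost in the moment bounds, must be negligible against the saving, while [M]
    distinct parts must sum to a positive proportion of [n], so that every part up to that size can
    be absorbed. Only parts of size linear in [n] remain, and they rarely make up a fixed share of
    [n]. With [x = exp(-t)] the weights of a pair have the product [x^j * x^(k - j) = x^k], the same
    for all [j]; the window is placed where it is about [3/10]. Only the sum [x^j + x^(k - j)]
    varies, and a bound linear in it leads to a geometric series, so that the saving is estimated
    without an integral. The parameter is [t = tau * n^(-1/2)], where [2 * tau * n^(1/2)] is the
    logarithm aimed at; [2 ^ y] is affordable because [t * y] stays below [2 * tau^2]. *)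

Fixpoint subsum (s : seq nat) (a : nat) : bool :=
  if s is x :: s' then subsum s' a || (x <= a) && subsum s' (a - x)
  else a == 0.

Lemma subsum_consP x s a :
  reflect (subsum s a \/ exists2 b, a = x + b & subsum s b) (subsum (x :: s) a).
Proof.
apply: (iffP orP) => -[H|H]; [by left| |by left|]; right.
  by case/andP: H => xa H; exists (a - x) => //; rewrite subnKC.
by case: H => b -> H; rewrite leq_addr addKn.
Qed.

Lemma sum_maskE (m : bitseq) (s : seq nat) : size m = size s ->
  \sum_(i < size s) nth false m i * nth 0 s i = sumn (mask m s).
Proof.
elim: s m => [|x s IHs] [|b m] //= => [_|[sz]]; first by rewrite big_ord0.
by rewrite big_ord_recl /= IHs //; case: b; rewrite ?mul1n ?mul0n.
Qed.

Lemma subsum_maskP s a :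
  reflect (exists2 m : bitseq, size m = size s & sumn (mask m s) = a)
    (subsum s a).
Proof.
elim: s a => [|x s IHs] a /=.
  apply: (iffP eqP) => [->|[m]]; first by exists [::].
  by move/eqP; rewrite size_eq0 => /eqP -> /=.
apply: (iffP (subsum_consP x s a)).
  case=> [/IHs[m sz <-]|[b -> /IHs[m sz <-]]].
    by exists (false :: m) => //=; rewrite sz.
  by exists (true :: m) => //=; rewrite sz.
case=> -[|[] m] //= [sz] <-.
  by right; exists (sumn (mask m s)) => //; apply/IHs; exists m.
by left; apply/IHs; exists m.
Qed.

Lemma representsE s a : represents s a = subsum s a.
Proof.
apply/existsP/subsum_maskP => [[eps /eqP->]|[m sz <-]].
  exists eps; first by rewrite size_tuple.
  rewrite -sum_maskE ?size_tuple //.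
  by apply: eq_bigr => i _; rewrite (tnth_nth false).
have szm : size m == size s by apply/eqP.
exists (Tuple szm); rewrite -sum_maskE //; apply/eqP.
by apply: eq_bigr => i _; rewrite (tnth_nth false).
Qed.

Lemma subsum_catP s t a :
  reflect (exists b c, [/\ a = b + c, subsum s b & subsum t c])
    (subsum (s ++ t) a).
Proof.
elim: s a => [|x s IHs] a /=.
  apply: (iffP idP) => [ta|[b [c [-> /eqP-> //]]]].
  by exists 0, a.
apply: (iffP (subsum_consP x (s ++ t) a)).
  case=> [/IHs[b [c [-> sb tc]]]|[_ -> /IHs[b [c [-> sb tc]]]]].
    by exists b, c; split=> //; apply/subsum_consP; left.
  exists (x + b), c; rewrite addnA; split=> //.
  by apply/subsum_consP; right; exists b.
case=> b [c [-> /subsum_consP[sb|[b' -> sb]] tc]].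
  by left; apply/IHs; exists b, c.
by right; exists (b' + c); [rewrite addnA|apply/IHs; exists b', c].
Qed.

Lemma subsum_catCA s1 s2 s3 a :
  subsum (s1 ++ s2 ++ s3) a -> subsum (s2 ++ s1 ++ s3) a.
Proof.
case/subsum_catP=> b [_ [-> H1 /subsum_catP[c [d [-> H2 H3]]]]].
apply/subsum_catP; exists c, (b + d); rewrite addnCA; split=> //.
by apply/subsum_catP; exists b, d.
Qed.

Lemma subsum_perm s t : perm_eq s t -> subsum s =1 subsum t.
Proof.
move=> st a; apply/idP/idP.
  by apply: (catCA_perm_ind (P := subsum^~ a)) st => *; apply: subsum_catCA.
rewrite perm_sym in st.
by apply: (catCA_perm_ind (P := subsum^~ a)) st => *; apply: subsum_catCA.
Qed.

Lemma subsum0 s : subsum s 0.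
Proof. by elim: s => //= x s ->. Qed.

Lemma subsum_le s a : subsum s a -> a <= sumn s.
Proof.
elim: s a => [|x s IHs] a /=; first by move/eqP->.
case/orP=> [/IHs H|/andP[xa /IHs H]]; lia.
Qed.

Lemma subsum_sym s a : subsum s a -> subsum s (sumn s - a).
Proof.
elim: s a => [|x s IHs] a //= /subsum_consP H; apply/subsum_consP.
case: H => [H|[b -> H]]; have := IHs _ H; have := subsum_le H => ? ?.
  by right; exists (sumn s - a) => //; lia.
by left; rewrite subnDl.
Qed.

(** A part [x <= L] shifts the interval [[lo, hi]] by at most its number of elements, so the
    interval and its translate leave no gap and cover [[lo, hi + x]]. The longer interval satisfies
    the same hypothesis, hence all of [t] can be added one by one. *)
Lemma subsum_interval s t lo hi L : lo <= hi -> L <= (hi - lo).+1 ->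
  (forall a, lo <= a <= hi -> subsum s a) -> all (fun x => x <= L) t ->
  forall a, lo <= a <= hi + sumn t -> subsum (t ++ s) a.
Proof.
elim: t s hi => [|x t IHt] s hi lohi hL sI /=; first by rewrite addn0.
case/andP=> xL tL a aI.
have tx : perm_eq ((x :: t) ++ s) (t ++ x :: s).
  by have /= -> := perm_catCA [:: x] t s (t ++ x :: s).
rewrite -[X in is_true X]/(subsum ((x :: t) ++ s) a) (subsum_perm tx).
apply: (IHt _ (hi + x)) => //; try lia.
move=> b bI; apply/subsum_consP; case: (leqP b hi) => bhi.
  by left; apply: sI; lia.
by right; exists (b - x); [lia|apply: sI; lia].
Qed.

(** Both [m, m, m] and [m, 2m] have exactly the sums [0], [m], [2m], [3m]. *)
Lemma subsum_triple m s : subsum [:: m, m, m & s] =1 subsum [:: m, m + m & s].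
Proof.
have mE : subsum [:: m; m; m] =1 subsum [:: m; m + m].
  by move=> a /=; lia.
move=> a; rewrite -[LHS]/(subsum ([:: m; m; m] ++ s) a).
rewrite -[RHS]/(subsum ([:: m; m + m] ++ s) a).
by apply/subsum_catP/subsum_catP => -[b [c [-> H1 H2]]];
  exists b, c; split=> //; rewrite ?mE // -mE.
Qed.

Lemma perm_cat_uniq_sub (t s : seq nat) : uniq t -> {subset t <= s} ->
  exists u, perm_eq s (t ++ u).
Proof.
elim: t s => [|x t IHt] s /=; first by exists s.
case/andP=> xt ut ts; have xs : x \in s by apply: ts; rewrite mem_head.
have /IHt : {subset t <= rem x s}.
  move=> y yt; have : y \in x :: rem x s.
    by rewrite -(perm_mem (perm_to_rem xs)); apply: ts; rewrite inE yt orbT.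
  by rewrite inE; case: eqP yt xt => // -> ->.
case=> // u pu; exists u; apply: perm_trans (perm_to_rem xs) _.
by rewrite perm_cons.
Qed.

Lemma path_ltn_sumn x t : path ltn x t -> size t * x + 'C((size t).+1, 2) <= sumn t.
Proof.
elim: t x => [|y t IHt] x //= /andP[xy /IHt H].
rewrite binS bin1; apply: leq_trans (leq_add (leqnn y) H).
have : size t * x + size t <= size t * y by rewrite -mulnSr leq_mul2l xy orbT.
by rewrite mulSn; lia.
Qed.

Lemma sumn_undup (s : seq nat) : sumn (undup s) <= sumn s.
Proof. by elim: s => //= x s IHs; case: ifP => _ /=; lia. Qed.

(** The condition [j.*2 < k] lists each unordered pair once and leaves out [j = k / 2], which would
    ask for two copies of one part; the listed pairs are pairwise disjoint. *)
Definition pair_count (s : seq nat) (k : nat) : nat :=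
  count (fun j => [&& j.*2 < k, j \in s & k - j \in s]) (iota 1 k).

Lemma pair_avoid (s T : seq nat) k : size T < pair_count s k ->
  exists j, [/\ 0 < j, j.*2 < k, (j \in s) && (k - j \in s)
                & (j \notin T) && (k - j \notin T)].
Proof.
rewrite /pair_count -size_filter; set F := seq.filter _ _ => TF.
have [/hasP[j]|/hasPn noj] := boolP (has (fun j => (j \notin T) && (k - j \notin T)) F).
  rewrite mem_filter mem_iota => /andP[/and3P[j1 j2 j3] /andP[j4 _]] j5.
  by exists j; rewrite j2 j3.
have FE j : j \in F -> j.*2 < k by rewrite mem_filter => /andP[/and3P[]].
(* If every pair met [T], sending each pair to an element of [T] in it would be injective, by
   disjointness, against [size T < pair_count s k]. *)
pose f j := if j \in T then j else k - j.
suff : size (map f F) <= size T by rewrite size_map leqNgt TF.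
apply: uniq_leq_size.
  rewrite map_inj_in_uniq ?filter_uniq ?iota_uniq // => i j /FE iF /FE jF.
  by rewrite /f; case: ifP; case: ifP => *; lia.
move=> _ /mapP[j /noj + ->]; rewrite /f negb_and !negbK.
by case: ifP => [jT _ |_ /=]; rewrite ?jT.
Qed.

(** The parts are split into [S] (one pair for each [k] of the window), [T] ([M] reserved small
    parts), [R1] (other parts up to [D = 'C(M.+1, 2)]) and [R2] (the huge parts). [S] gives the
    window, [T] lengthens it by at least [D], after which the parts of [R1] can be added. As [S] and
    [R2] together hold at most half of the total, the interval reaches the middle, and the symmetry
    of subset sums gives the rest. *)
Lemma subsum_middle (s : seq nat) (y1 y2 w M H : nat) :
  y1 <= y2 -> w <= (y2 - y1).+1 ->
  (forall k, y1 <= k <= y2 -> M < pair_count s k) ->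
  M <= count (mem s) (iota 1 w) ->
  sumn [seq x <- s | 'C(M.+1, 2) < x] <= H ->
  (\sum_(y1 <= k < y2.+1) k + H).*2 <= sumn s ->
  forall a, y1 <= a <= sumn s - y1 -> subsum s a.
Proof.
move=> y12 hw hpair hsmall hhuge htot.
pose T := take M [seq j <- iota 1 w | j \in s].
have sT : size T = M.
  by rewrite size_takel // size_filter.
have subT : subseq T (iota 1 w).
  exact: subseq_trans (take_subseq _ _) (filter_subseq _ _).
have uT : uniq T by apply: subseq_uniq subT (iota_uniq _ _).
have Ts : {subset T <= s}.
  by move=> x /mem_take; rewrite mem_filter => /andP[].
have Tw : all (fun x => x <= w) T.
  by apply/allP => x /(mem_subseq subT); rewrite mem_iota; lia.
have sumT : 'C(M.+1, 2) <= sumn T.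
  have : path ltn 0 T.
    have := subseq_trans subT (subseq_refl _) => subT'.
    apply: (subseq_path ltn_trans subT').
    by have := iota_ltn_sorted 0 w.+1.
  by move/path_ltn_sumn; rewrite sT muln0.
pose ok k j := [&& 0 < j, j.*2 < k, j \in s, k - j \in s, j \notin T & k - j \notin T].
pose f k := if [pick j : 'I_k | ok k j] is Some j then nat_of_ord j else 0.
have fP k : y1 <= k <= y2 -> ok k (f k).
  move=> /hpair; rewrite -sT => /pair_avoid[j [j1 j2 /andP[j3 j4] /andP[j5 j6]]].
  have jk : j < k by lia.
  rewrite /f; case: pickP => [//|/(_ (Ordinal jk))].
  by rewrite /ok /= j1 j2 j3 j4 j5 j6.
pose S0 := flatten [seq [:: f k; k - f k] | k <- index_iota y1 y2.+1].
(* Pairs of different [k] may share parts. This is harmless, since the target [k] uses its own pair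
   only. *)
pose S := undup S0.
have inS0 x : x \in S0 -> exists2 k, y1 <= k <= y2 & (x = f k) \/ (x = k - f k).
  case/flattenP=> _ /mapP[k + ->]; rewrite mem_index_iota ltnS => kI.
  by rewrite !inE => /orP[]/eqP->; exists k => //; [left|right].
have sumS : sumn S <= \sum_(y1 <= k < y2.+1) k.
  apply: leq_trans (sumn_undup _) _; rewrite /S0 sumn_flatten -map_comp sumnE big_map.
  rewrite big_seq [in X in _ <= X]big_seq.
  apply: leq_sum => k; rewrite mem_index_iota ltnS => /fP /and5P[_ k1 _ _ _] /=; lia.
have [R pR] : exists R, perm_eq s ((S ++ T) ++ R).
  apply: perm_cat_uniq_sub.
    rewrite cat_uniq undup_uniq uT andbT /=; apply/hasPn => x xT.
    apply/negP; rewrite /= mem_undup => /inS0[k /fP /and5P[_ _ _ _ /andP[k1 k2]]].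
    by case=> xE; move: k1 k2; rewrite -?xE xT.
  move=> x; rewrite mem_cat mem_undup => /orP[|/Ts //].
  by case/inS0=> k /fP /and5P[_ _ k1 k2 _] [->|->].
pose D := 'C(M.+1, 2).
pose R1 := [seq x <- R | x <= D]; pose R2 := [seq x <- R | predC (leq^~ D) x].
have pR12 : perm_eq (R1 ++ R2) R by rewrite perm_filterC.
have sumR2 : sumn R2 <= H.
  apply: leq_trans hhuge.
  rewrite (perm_sumn (perm_filter _ pR)) !filter_cat !sumn_cat.
  have -> : R2 = [seq x <- R | D < x] by apply: eq_filter => x /=; rewrite ltnNge.
  exact: leq_addl.
have sumE : sumn s = sumn S + sumn T + (sumn R1 + sumn R2).
  by rewrite (perm_sumn pR) !sumn_cat -(perm_sumn pR12) sumn_cat.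
have SI a : y1 <= a <= y2 -> subsum S a.
  move=> aI; have /and5P[a1 a2 a3 a4 /andP[a5 a6]] := fP _ aI.
  have aS0 : a \in index_iota y1 y2.+1 by rewrite mem_index_iota ltnS.
  have [||u pu] := @perm_cat_uniq_sub [:: f a; a - f a] S.
  - by rewrite /= inE andbT; move: (f a) a2; clear; lia.
  - move=> x xa; rewrite mem_undup; apply/flattenP.
    by exists [:: f a; a - f a] => //; apply/mapP; exists a.
  rewrite (subsum_perm pu); apply/subsum_catP; exists a, 0.
  by rewrite addn0 subsum0; split=> //=; move: (f a) a2; clear; lia.
have STI := subsum_interval y12 hw SI Tw.
have DL : D <= (y2 + sumn T - y1).+1 by rewrite /D; lia.
have y12' : y1 <= y2 + sumn T by lia.
have STRI := subsum_interval y12' DL STI (filter_all _ R).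
have low a : y1 <= a -> a.*2 <= sumn s -> subsum s a.
  move=> a1 a2; have pE : perm_eq s (R2 ++ (R1 ++ T ++ S)).
    apply/permP => P; rewrite (permP pR) !count_cat -(permP pR12) count_cat; lia.
  rewrite (subsum_perm pE); apply/subsum_catP; exists 0, a.
  rewrite subsum0; split=> //; apply: STRI; rewrite a1 /= -/R1; lia.
move=> a /andP[a1 a2].
have [|h] := leqP a.*2 (sumn s); first exact: low.
have aE : sumn s - (sumn s - a) = a by rewrite subKn; lia.
by rewrite -aE; apply: subsum_sym; apply: low; lia.
Qed.

(** * Partitions with restricted multiplicities *)

Definition restricted (r n : nat) : {set n.-bseq 'I_n.+1} :=
  [set s in partitions n | [forall i : 'I_n.+1, count_mem (i : nat) (parts s) <= r]].

Definition num_sets (r n : nat) : nat :=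
  #|[set represented_set s | s in restricted r n]|.

Lemma parts_le n (s : n.-bseq 'I_n.+1) x : x \in parts s -> x <= n.
Proof. by case/mapP=> i _ ->; rewrite -ltnS. Qed.

Lemma count_mem_restricted r n s x : s \in restricted r n ->
  count_mem x (parts s) <= r.
Proof.
rewrite inE => /andP[_ /forallP sr].
have [xn|xn] := leqP x n; first exact: (sr (Ordinal (xn : x < n.+1))).
rewrite (count_memPn _) //; apply/negP => /parts_le; lia.
Qed.

Lemma mem_represented_set n (s : n.-bseq 'I_n.+1) (a : 'I_n.+1) :
  (a \in represented_set s) = subsum (parts s) a.
Proof. by rewrite inE representsE. Qed.

Lemma qhat_le n : qhat n <= num_sets 1 n.
Proof.
apply/subset_leq_card/imsetS/fintype.subsetP => s; rewrite !inE => /andP[-> us] /=.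
by apply/forallP => i; rewrite count_uniq_mem // leq_b1.
Qed.

Lemma perm_nseq_cat k i (s : seq nat) : k <= count_mem i s ->
  exists u, perm_eq s (nseq k i ++ u).
Proof.
elim: k s => [|k IHk] s ks; first by exists s.
have is_ : i \in s by rewrite -has_pred1 has_count; lia.
have pE := perm_to_rem is_.
have [|u pu] := IHk (rem i s).
  by move: ks; rewrite (permP pE) /= eqxx.
by exists u; apply: perm_trans pE _; rewrite /= perm_cons.
Qed.

(** Trading [i, i, i] for [i, 2i] shortens the partition by one part, so the induction on the size
    ends, even though a step may push the multiplicity of [2i] above 2. *)
Lemma subsum_restrict2 n s : is_partition n s ->
  exists s', [/\ is_partition n s', forall i, count_mem i s' <= 2
                & subsum s =1 subsum s'].
Proof.
have [k] := ubnP (size s); elim: k s => // k IHk s sk sP.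
have [/hasP[i _ /perm_nseq_cat[u pu]]|/hasPn s2] :=
    boolP (has (fun i => 2 < count_mem i s) s); last first.
  exists s; split=> // i; have [/s2|/count_memPn -> //] := boolP (i \in s).
  by rewrite -leqNgt.
have {sP}/and3P[_ s0 /eqP sn] := sP.
pose s1 := sort leq [:: i, i + i & u].
have ps1 : perm_eq s1 [:: i, i + i & u] by apply/permPl/perm_sort.
have [|| s' [s'P s'2 s'E]] := IHk s1.
- by rewrite (perm_size ps1) /=; move: sk; rewrite (perm_size pu) /=; lia.
- rewrite /is_partition sort_sorted /=; last exact: leq_total.
  rewrite (perm_all _ ps1) (perm_sumn ps1) -sn (perm_sumn pu) /=.
  by move: s0; rewrite (perm_all _ pu) /= => /and4P[i0 _ _ ->]; rewrite i0 addn_gt0 i0 /=; lia.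
exists s'; split=> // a.
by rewrite -s'E (subsum_perm pu) /= (subsum_perm ps1) -[LHS]/(subsum [:: i, i, i & u] a) subsum_triple.
Qed.

Lemma phat_le n : phat n <= num_sets 2 n.
Proof.
apply/subset_leq_card/fintype.subsetP => _ /imsetP[s sP ->].
have : is_partition n (parts s) by move: sP; rewrite inE.
case/subsum_restrict2=> _ [/partitions_complete[s' s'P <-] s'2 s'E].
apply/imsetP; exists s'; last by apply/setP => a; rewrite !mem_represented_set s'E.
by rewrite inE s'P; apply/forallP => i; apply: s'2.
Qed.

(* Represented sets are symmetric under [a |-> n - a]. *)
Lemma num_sets_bound (r n y : nat) (bad : pred (seq nat)) :
  (forall s, s \in restricted r n -> ~~ bad (parts s) ->
     forall a, y <= a <= n - y -> subsum (parts s) a) ->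
  num_sets r n <= 2 ^ y + #|[set s in restricted r n | bad (parts s)]|.
Proof.
move=> good.
pose P0 := [set s in restricted r n | ~~ bad (parts s)].
pose P1 := [set s in restricted r n | bad (parts s)].
have PE : restricted r n = P0 :|: P1.
  by apply/setP => s; rewrite !inE; case: (bad _); rewrite /= ?andbF ?andbT ?orbF.
have -> : num_sets r n = #|(@represented_set n @: P0) :|: (@represented_set n @: P1)|.
  by rewrite -imsetU -PE.
apply: leq_trans (leq_card_setU _ _) _; apply: leq_add; last exact: leq_imset_card.
pose low (E : {set 'I_n.+1}) := [set a in E | a < y].
have sumP s : s \in restricted r n -> sumn (parts s) = n.
  by rewrite 2!inE => /andP[/and3P[_ _ /eqP]].
(* A good set contains all of [[y, n - y]] and is symmetric, so its truncation below [y] determines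
   it. *)
rewrite -(@card_in_imset _ _ low).
  apply: leq_trans (subset_leq_card (_ : _ \subset powerset [set a : 'I_n.+1 | a < y])) _.
    apply/fintype.subsetP => _ /imsetP[E _ ->]; rewrite inE; apply/fintype.subsetP => a.
    by rewrite !inE => /andP[].
  rewrite card_powerset leq_exp2l // cardE -(size_map val) -[y in _ <= y](size_iota 0).
  apply: uniq_leq_size; first by rewrite map_inj_uniq ?enum_uniq //; apply: val_inj.
  by move=> _ /mapP[a + ->]; rewrite mem_enum inE mem_iota.
move=> _ _ /imsetP[s sP0 ->] /imsetP[s' s'P0 ->] low_eq0.
have /andP[sP sb] : (s \in restricted r n) && ~~ bad (parts s).
  by move: sP0; rewrite inE.
have /andP[s'P s'b] : (s' \in restricted r n) && ~~ bad (parts s').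
  by move: s'P0; rewrite inE.
have low_eq a : (a \in low (represented_set s)) = (a \in low (represented_set s')).
  by rewrite low_eq0.
have lowE a : a < y -> a <= n -> subsum (parts s) a = subsum (parts s') a.
  move=> ay an; have := low_eq (Ordinal (an : a < n.+1)).
  by rewrite !inE !representsE /= ay !andbT.
apply/setP => a; rewrite !mem_represented_set; have an : a <= n by rewrite -ltnS.
have [ay|ya] := ltnP a y; first exact: lowE.
have [ayn|yan] := leqP a (n - y).
  by rewrite (good s) ?(good s') ?ya.
have symE t : t \in restricted r n -> subsum (parts t) a = subsum (parts t) (n - a).
  move=> /sumP tn; apply/idP/idP => /subsum_sym; rewrite tn // subKn //.
by rewrite !symE // lowE //; lia.
Qed.

(** * Multiplicity vectors *)

(** Coordinate [i] holds the multiplicity of the part [i.+1], which [inord] preserves on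
    [restricted r n]. The indices reach the part [n.+1]; this is why the products below stop before
    [n.+2]. *)
Definition mult_vec (r n : nat) (s : seq nat) : {ffun 'I_n.+1 -> 'I_r.+1} :=
  [ffun i : 'I_n.+1 => inord (count_mem i.+1 s)].

Lemma mult_vecE r n s (i : 'I_n.+1) : s \in restricted r n ->
  mult_vec r n (parts s) i = count_mem i.+1 (parts s) :> nat.
Proof. by move=> sP; rewrite ffunE inordK // ltnS (count_mem_restricted _ sP). Qed.

Lemma parts_gt0 r n s x : s \in restricted r n -> x \in parts s -> 0 < x.
Proof. by rewrite 2!inE => /andP[/and3P[_ /allP s0 _] _] /s0. Qed.

Lemma mult_vec_inj r n : {in restricted r n &, injective (fun s => mult_vec r n (parts s))}.
Proof.
move=> s t sP tP st; apply: parts_inj; apply: (sorted_eq leq_trans anti_leq).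
- by move: sP; rewrite 2!inE => /andP[/and3P[]].
- by move: tP; rewrite 2!inE => /andP[/and3P[]].
apply/allP => x _ /=; apply/eqP; case: x => [|x].
  by rewrite !(count_memPn _) //; apply/negP => /parts_gt0 => /(_ r); rewrite ?sP ?tP => /(_ isT).
have [xn|xn] := ltnP x n.+1; last first.
  by rewrite !(count_memPn _) //; apply/negP => /parts_le; lia.
by rewrite -(mult_vecE (Ordinal xn) sP) st mult_vecE.
Qed.

Lemma sum_count_mem n (s : seq nat) (f : nat -> nat) :
  (forall x, x \in s -> 0 < x <= n.+1) ->
  \sum_(x <- s) f x = \sum_(i < n.+1) count_mem i.+1 s * f i.+1.
Proof.
elim: s => [|x s IHs] sI.
  by rewrite big_nil big1 // => i _; rewrite mul0n.
rewrite big_cons IHs; last by move=> y ys; apply: sI; rewrite inE ys orbT.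
under [in RHS]eq_bigr => i _ do rewrite /= mulnDl.
rewrite big_split /=; congr (_ + _).
have /andP[x0 xn] := sI x (mem_head _ _).
have xn' : x.-1 < n.+1 by lia.
rewrite (bigD1 (Ordinal xn')) //= prednK // eqxx mul1n big1 ?addn0 //.
by move=> i /eqP ix; case: eqP => // xi; case: ix; apply: val_inj; rewrite /= xi.
Qed.

Definition mult_sum (r n : nat) (v : {ffun 'I_n -> 'I_r.+1}) : nat :=
  \sum_(i < n) i.+1 * v i.

Definition seq_of_mult (r n : nat) (v : {ffun 'I_n -> 'I_r.+1}) : seq nat :=
  sort leq (flatten [seq nseq (v i) i.+1 | i <- enum 'I_n]).

Lemma count_seq_of_mult r n (v : {ffun 'I_n -> 'I_r.+1}) (i : 'I_n) :
  count_mem i.+1 (seq_of_mult v) = v i.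
Proof.
rewrite /seq_of_mult count_sort count_flatten sumnE -map_comp big_map /= big_enum /=.
rewrite (bigD1 i) //= count_nseq /= eqxx mul1n big1 ?addn0 // => j ji.
by rewrite count_nseq /= eqSS (inj_eq val_inj) (negbTE ji).
Qed.

Lemma mem_seq_of_mult r n (v : {ffun 'I_n -> 'I_r.+1}) x :
  x \in seq_of_mult v -> exists i : 'I_n, x = i.+1.
Proof.
rewrite mem_sort => /flattenP[_ /mapP[i _ ->]].
by rewrite mem_nseq => /andP[_ /eqP->]; exists i.
Qed.

Lemma sumn_seq_of_mult r n (v : {ffun 'I_n -> 'I_r.+1}) : sumn (seq_of_mult v) = mult_sum v.
Proof.
rewrite (perm_sumn (permEl (perm_sort _ _))) sumn_flatten -map_comp sumnE big_map.
by rewrite big_enum /=; apply: eq_bigr => i _; rewrite sumn_nseq.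
Qed.

Definition bump_last (d : nat) (s : seq nat) : seq nat :=
  if s is x :: s' then rcons (belast x s') (last x s' + d) else [::].

Lemma bump_lastE d s x : bump_last d (rcons s x) = rcons s (x + d).
Proof. by case: s => //= y s; rewrite belast_rcons last_rcons. Qed.

Lemma bump_last_inj d : injective (bump_last d).
Proof.
move=> s t; case: (lastP s) => [|s' x]; case: (lastP t) => [|t' y] //; rewrite ?bump_lastE.
- by move/(congr1 size); rewrite size_rcons.
- by move/(congr1 size); rewrite size_rcons.
by move/rcons_inj => [-> /addIn ->].
Qed.

Lemma sorted_rcons_ge (e : rel nat) s x y : transitive e -> (forall z, e z x -> e z y) ->
  sorted e (rcons s x) -> sorted e (rcons s y).
Proof.
move=> tr xy; case: s => //= z s; rewrite !rcons_path => /andP[-> H].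
exact: xy.
Qed.

(* Increasing the last part of a partition of [m] by [n - m] gives a partition of [n]. *)
Lemma card_mult_sum (r n m : nat) (P : {set n.-bseq 'I_n.+1}) : 0 < m <= n ->
  (forall v : {ffun 'I_n -> 'I_r.+1}, mult_sum v = m ->
    forall t : n.-bseq 'I_n.+1, t \in partitions n ->
    parts t = bump_last (n - m) (seq_of_mult v) -> t \in P) ->
  #|[set v : {ffun 'I_n -> 'I_r.+1} | mult_sum v == m]| <= #|P|.
Proof.
move=> /andP[m0 mn] hP; set A := [set v | _].
rewrite cardE -(size_map (fun v => bump_last (n - m) (seq_of_mult v))).
rewrite [leqRHS]cardE -(size_map (@parts n)).
apply: uniq_leq_size.
  rewrite map_inj_uniq ?enum_uniq // => v w /bump_last_inj vw.
  by apply/ffunP => i; apply: val_inj; rewrite /= -!count_seq_of_mult vw.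
move=> _ /mapP[v + ->]; rewrite mem_enum inE => /eqP vm.
have : is_partition n (bump_last (n - m) (seq_of_mult v)).
  have := sort_sorted leq_total (flatten [seq nseq (v i) i.+1 | i <- enum 'I_n]).
  have : all (ltn 0) (seq_of_mult v) by apply/allP => x /mem_seq_of_mult[i ->].
  have := sumn_seq_of_mult v; rewrite -/(seq_of_mult v) vm.
  case: (lastP (seq_of_mult v)) => [/= E|s x]; first by rewrite -E in m0.
  rewrite bump_lastE /is_partition !all_rcons !sumn_rcons => sE /andP[x0 s0] srt.
  have -> /= : sorted leq (rcons s (x + (n - m))).
    by apply: sorted_rcons_ge srt; [exact: leq_trans|move=> z; lia].
  apply/andP; split; last by move: sE; rewrite /=; lia.
  by apply/andP; split; [move: x0 => /=; lia|exact: s0].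
by case/partitions_complete=> t tP tE; apply/mapP; exists t; rewrite ?mem_enum ?(hP v).
Qed.

Lemma card_mult_sum_p (r n m : nat) : 0 < m <= n ->
  #|[set v : {ffun 'I_n -> 'I_r.+1} | mult_sum v == m]| <= p n.
Proof. by move=> mn; apply: card_mult_sum. Qed.

(** Multiplicities at most 1 make the parts distinct, and enlarging the largest part keeps them
    strictly increasing. *)
Lemma card_mult_sum_q (n m : nat) : 0 < m <= n ->
  #|[set v : {ffun 'I_n -> 'I_2} | mult_sum v == m]| <= q n.
Proof.
move=> mn; apply: card_mult_sum => // v _ t tP tE; rewrite inE tP tE.
have us : uniq (seq_of_mult v).
  apply: count_mem_uniq => x; have [xv|xv] := boolP (x \in seq_of_mult v); last exact/count_memPn.
  have [i xi] := mem_seq_of_mult xv; have : 0 < count_mem x (seq_of_mult v) by rewrite -has_count has_pred1.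
  by rewrite xi count_seq_of_mult; case: (v i) => -[|[]].
have : sorted ltn (seq_of_mult v).
  by rewrite ltn_sorted_uniq_leq us sort_sorted //; exact: leq_total.
case: (lastP (seq_of_mult v)) => // s x srt; rewrite bump_lastE.
suff : sorted ltn (rcons s (x + (n - m))) by rewrite ltn_sorted_uniq_leq => /andP[].
by apply: sorted_rcons_ge srt; [exact: ltn_trans|move=> z /=; lia].
Qed.

Local Open Scope ring_scope.

(** * Exponential moment bounds *)

(** The abstract moment method: [f] encodes the counted objects, and the weight is at least 1 on
    their codes. Summing over all codes, not only those that occur, is what lets the sum factor over
    the coordinates. *)
Lemma card_le_sum (R : realFieldType) (T U : finType) (A : {set T}) (f : T -> U) (W : U -> R) :
  {in A &, injective f} -> (forall u, 0 <= W u) -> (forall s, s \in A -> 1 <= W (f s)) ->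
  #|A|%:R <= \sum_u W u.
Proof.
move=> fI W0 W1.
have -> : #|A|%:R = \sum_(s in A) (1 : R) by rewrite sumr_const.
apply: (@le_trans _ _ (\sum_(s in A) W (f s))); first exact: ler_sum.
rewrite -(big_imset W fI) /= [leRHS](bigID (mem (f @: A))) /= lerDl.
by apply: sumr_ge0.
Qed.

Definition part_weight (R : realFieldType) (r : nat) (x : R) : R := \sum_(c < r.+1) x ^+ c.

Lemma expr_count (R : realFieldType) (T : eqType) (P : pred T) (s : seq T) (l : R) :
  l ^+ count P s = \prod_(j <- s) (if P j then l else 1).
Proof.
elim: s => [|x s IHs]; first by rewrite big_nil.
by rewrite big_cons /= exprD IHs; case: (P x).
Qed.

Lemma prod_ord_parts (R : realFieldType) (n : nat) (a : nat -> R) :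
  \prod_(i < n) a i.+1 = \prod_(1 <= j < n.+1) a j.
Proof. by rewrite big_add1 /= big_mkord. Qed.

(** The factor of [k - j] moves to [j] and leaves 1 behind; the midpoint [k / 2], having no partner,
    and the indices from [k] on keep their own factor. *)
Lemma prod_pairs (R : realFieldType) (N k : nat) (a : nat -> R) : (0 < k <= N)%N ->
  \prod_(1 <= j < N) a j =
  \prod_(1 <= j < N) (if (j.*2 < k)%N then a j * a (k - j)%N
                      else if (k < j.*2)%N && (j < k)%N then 1 else a j).
Proof.
case/andP=> k0 kN.
rewrite (@big_cat_nat _ _ _ k) // [RHS](@big_cat_nat _ _ _ k) //=; congr (_ * _); last first.
  apply: eq_big_nat => j /andP[j1 j2].
  by case: ifP => [|_]; [lia|case: ifP => //; lia].
rewrite (bigID (fun j => (j.*2 < k)%N)) [RHS](bigID (fun j => (j.*2 < k)%N)) /=.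
have -> : \prod_(1 <= j < k | (j.*2 < k)%N)
   (if (j.*2 < k)%N then a j * a (k - j)%N
                      else if (k < j.*2)%N && (j < k)%N then 1 else a j) =
   \prod_(1 <= j < k | (j.*2 < k)%N) a j * \prod_(1 <= j < k | (j.*2 < k)%N) a (k - j)%N.
  by rewrite -big_split /=; apply: eq_bigr => j ->.
rewrite -mulrA; congr (_ * _).
rewrite (bigID (fun j => (k < j.*2)%N)) /=; congr (_ * _).
  rewrite big_nat_rev /= big_nat_cond [RHS]big_nat_cond.
  apply: eq_big => [j|j /andP[jI _]]; first by apply/idP/idP; lia.
  by congr a; lia.
rewrite [RHS](bigID (fun j => (k < j.*2)%N)) /= [X in X * _]big1_seq ?mul1r; last first.
  move=> j /andP[/andP[/negbTE -> j2]]; rewrite mem_index_iota => /andP[_ j3].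
  by rewrite j2 j3.
by apply: eq_bigr => j /andP[/negbTE -> /negbTE ->].
Qed.

Section Chernoff.
Variables (R : realFieldType) (r n : nat) (x : R).
Hypothesis x0 : 0 < x.

Let a (s : seq nat) (j : nat) : R := x ^+ (j * count_mem j s).

Lemma prod_parts s : s \in restricted r n ->
  \prod_(1 <= j < n.+2) a (parts s) j = x ^+ n.
Proof.
move=> sP; have sI y : y \in parts s -> (0 < y <= n.+1)%N.
  by move=> ys; rewrite (parts_gt0 sP ys) /=; have := parts_le ys; lia.
have sn : sumn (parts s) = n by move: sP; rewrite 2!inE => /andP[/and3P[_ _ /eqP]].
rewrite -prod_ord_parts /a prodrXr; congr (_ ^+ _).
rewrite -[RHS]sn sumnE (sum_count_mem id sI).
by apply: eq_bigr => i _; rewrite mulnC.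
Qed.

(* Markov's inequality for [y ^- (sum of the parts above D)]. *)
Lemma many_large_parts (D H : nat) (y z : R) : 0 < y -> y <= 1 -> 0 < z -> x = y * z ->
  x ^+ n *
    #|[set s in restricted r n | (H < sumn [seq i <- parts s | (D < i)%N])%N]|%:R <=
  y ^+ H * \prod_(1 <= j < n.+2) (if (j <= D)%N then part_weight r (x ^+ j) else part_weight r (z ^+ j)).
Proof.
move=> y0 y1 z0 xE; set A := [set s in _ | _].
pose F (i : 'I_n.+1) (c : 'I_r.+1) : R :=
  (if (i.+1 <= D)%N then x else z) ^+ (i.+1 * c).
have F0 i c : 0 <= F i c by rewrite /F; case: ifP => _; apply: exprn_ge0; exact: ltW.
have xn0 : 0 < x ^+ n by rewrite exprn_gt0.
rewrite mulrC -ler_pdivlMr // mulrAC.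
pose W (v : {ffun 'I_n.+1 -> 'I_r.+1}) := y ^+ H / x ^+ n * \prod_i F i (v i).
have := @card_le_sum R _ _ A (fun s => mult_vec r n (parts s)) W.
rewrite /W -mulr_sumr -(bigA_distr_bigA F) /=.
have -> : \prod_(i < n.+1) \sum_j F i j = \prod_(1 <= j < n.+2)
    (if (j <= D)%N then part_weight r (x ^+ j) else part_weight r (z ^+ j)).
  rewrite -prod_ord_parts; apply: eq_bigr => i _.
  by rewrite /part_weight /F; case: (i.+1 <= D)%N; apply: eq_bigr => c _; rewrite exprM.
apply.
- by move=> s t; rewrite !inE => /andP[sP _] /andP[tP _]; apply: mult_vec_inj; rewrite ?inE.
- by move=> v; apply: mulr_ge0; [rewrite divr_ge0 // exprn_ge0 // ltW|apply: prodr_ge0].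
move=> s; rewrite inE => /andP[sP sH].
have sI i : i \in parts s -> (0 < i <= n.+1)%N.
  by move=> ys; rewrite (parts_gt0 sP ys) /=; have := parts_le ys; lia.
have hE : sumn [seq i <- parts s | (D < i)%N] =
    \sum_(i < n.+1) count_mem i.+1 (parts s) * (if (D < i.+1)%N then i.+1 else 0).
  by rewrite sumnE big_filter big_mkcond /= (sum_count_mem (fun j => if (D < j)%N then j else 0%N) sI).
(* [F] weighs the large parts by [z] instead of [x = y * z]; the missing factor is [y] to the sum of
   the large parts, hence at most [y ^+ H]. *)
have FE : x ^+ n = \prod_i F i (mult_vec r n (parts s) i) * y ^+ sumn [seq i <- parts s | (D < i)%N].
  rewrite hE -prodrXr -big_split /= -(prod_parts sP) -prod_ord_parts.
  apply: eq_bigr => i _; rewrite /a /F (mult_vecE _ sP) [X in y ^+ X]mulnC (ltnNge D).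
  by case: (i.+1 <= D)%N => /=; rewrite ?mul0n ?mulr1 // xE -exprMn mulrC.
rewrite mulrAC ler_pdivlMr // mul1r [leLHS]FE mulrC ler_wpM2r //.
  by apply: prodr_ge0.
by apply: ler_wiXn2l; [exact: ltW|exact: y1|exact: ltnW].
Qed.

Variable l : R.
Hypotheses (l0 : 0 < l) (l1 : l <= 1).

(** Each size up to [w] that occurs is charged one factor [l <= 1], whatever its multiplicity; fewer
    than [M] such sizes leave a weight of at least [l ^+ M]. *)
Lemma few_small_parts (w M : nat) : (w <= n.+1)%N ->
  x ^+ n * l ^+ M *
    #|[set s in restricted r n | (count (mem (parts s)) (iota 1 w) < M)%N]|%:R <=
  \prod_(1 <= j < n.+2) (if (j <= w)%N then 1 + l * (part_weight r (x ^+ j) - 1)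
                         else part_weight r (x ^+ j)).
Proof.
move=> wn; set A := [set s in _ | _].
pose F (i : 'I_n.+1) (c : 'I_r.+1) : R :=
  x ^+ (i.+1 * c) * (if (i.+1 <= w)%N && (0 < c)%N then l else 1).
have F0 i c : 0 <= F i c by apply: mulr_ge0; [exact: exprn_ge0 (ltW _)|case: ifP => // _; exact: ltW].
have xn0 : 0 < x ^+ n * l ^+ M by rewrite mulr_gt0 // exprn_gt0.
rewrite mulrC -ler_pdivlMr //.
pose W (v : {ffun 'I_n.+1 -> 'I_r.+1}) := (\prod_i F i (v i)) / (x ^+ n * l ^+ M).
have := @card_le_sum R _ _ A (fun s => mult_vec r n (parts s)) W.
rewrite /W -mulr_suml -(bigA_distr_bigA F) /=.
have -> : \prod_(i < n.+1) \sum_j F i j = \prod_(1 <= j < n.+2)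
    (if (j <= w)%N then 1 + l * (part_weight r (x ^+ j) - 1) else part_weight r (x ^+ j)).
  rewrite -prod_ord_parts; apply: eq_bigr => i _.
  rewrite /part_weight !big_ord_recl /F /= muln0 !expr0 mul1r ltnn andbF addrAC subrr add0r.
  case: (i < w)%N; congr (_ + _); last first.
    by apply: eq_bigr => c _; rewrite /= mulr1 exprM.
  rewrite mulr_sumr; apply: eq_bigr => c _.
  by rewrite /= mulrC exprM.
apply.
- by move=> s t; rewrite !inE => /andP[sP _] /andP[tP _]; apply: mult_vec_inj; rewrite ?inE.
- by move=> v; apply: divr_ge0; [apply: prodr_ge0|exact: ltW].
move=> s; rewrite inE => /andP[sP sM]; rewrite ler_pdivlMr // mul1r.
have -> : \prod_i F i (mult_vec r n (parts s) i) =
  \prod_(i < n.+1) a (parts s) i.+1 *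
  \prod_(i < n.+1) (if (i.+1 <= w)%N && (i.+1 \in parts s) then l else 1).
  rewrite -big_split /=; apply: eq_bigr => i _; rewrite /F (mult_vecE _ sP).
  by rewrite -has_count has_pred1.
rewrite prod_ord_parts prod_parts // ler_pM2l ?exprn_gt0 //.
rewrite (prod_ord_parts n.+1 (fun j => if (j <= w)%N && (j \in parts s) then l else 1)).
rewrite (@big_cat_nat _ _ _ w.+1) //= [X in _ * X]big1_seq ?mulr1; last first.
  by move=> j /andP[_]; rewrite mem_index_iota => /andP[wj _]; rewrite leqNgt wj.
rewrite (_ : \prod_(1 <= j < w.+1) _ = l ^+ count (mem (parts s)) (iota 1 w)).
  by apply: ler_wiXn2l => //; [exact: ltW|exact: ltnW].
rewrite expr_count /index_iota subn1 /= !big_seq; apply: eq_bigr => j.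
by rewrite mem_iota => /andP[_ jw]; rewrite -ltnS jw.
Qed.

(* The coordinates [j] and [k - j] are grouped into a single one, so that the
   weighted sum factors; the coordinates [k/2 < j < k] become trivial. *)
Lemma few_pairs (k M : nat) : (0 < k <= n.+1)%N ->
  x ^+ n * l ^+ M *
    #|[set s in restricted r n | (pair_count (parts s) k <= M)%N]|%:R <=
  \prod_(1 <= j < n.+2) part_weight r (x ^+ j) *
  \prod_(1 <= j < k | (j.*2 < k)%N)
     (1 - (1 - l) * (1 - (part_weight r (x ^+ j))^-1) * (1 - (part_weight r (x ^+ (k - j)))^-1)).
Proof.
move=> /andP[k0 kn]; set A := [set s in _ | _].
pose low (j : nat) := (j.*2 < k)%N; pose high (j : nat) := (k < j.*2)%N && (j < k)%N.
pose F (i : 'I_n.+1) (c : 'I_r.+1 * 'I_r.+1) : R :=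
  if low i.+1 then x ^+ (i.+1 * c.1) * x ^+ ((k - i.+1) * c.2) *
                   (if (0 < c.1)%N && (0 < c.2)%N then l else 1)
  else if high i.+1 then ((c.1 == ord0) && (c.2 == ord0))%:R
  else x ^+ (i.+1 * c.1) * (c.2 == ord0)%:R.
have F0 i c : 0 <= F i c.
  have xj j : 0 <= x ^+ j by apply: exprn_ge0; exact: ltW.
  rewrite /F; case: ifP => _; first by rewrite !mulr_ge0 //; case: ifP => // _; exact: ltW.
  by case: ifP => _; rewrite ?mulr_ge0.
have xn0 : 0 < x ^+ n * l ^+ M by rewrite mulr_gt0 // exprn_gt0.
have g1 j : 1 <= part_weight r (x ^+ j).
  rewrite /part_weight big_ord_recl expr0 lerDl; apply: sumr_ge0 => i _.
  by rewrite !exprn_ge0 // ltW.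
rewrite mulrC -ler_pdivlMr //.
pose W (v : {ffun 'I_n.+1 -> 'I_r.+1 * 'I_r.+1}) := (\prod_i F i (v i)) / (x ^+ n * l ^+ M).
(* A low coordinate [j] records the multiplicities of [j] and [k - j] together, so the constant
   value at the high coordinates loses no information. *)
pose f (s : n.-bseq 'I_n.+1) : {ffun 'I_n.+1 -> 'I_r.+1 * 'I_r.+1} :=
  [ffun i : 'I_n.+1 => let cnt j : 'I_r.+1 := inord (count_mem j (parts s)) in
    if low i.+1 then (cnt i.+1, cnt (k - i.+1)%N)
    else if high i.+1 then (ord0, ord0) else (cnt i.+1, ord0)].
have := @card_le_sum R _ _ A f W.
rewrite /W -mulr_suml -(bigA_distr_bigA F) /=.
have sumC j : \sum_(c < r.+1) x ^+ (j * c) = part_weight r (x ^+ j).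
  by apply: eq_bigr => c _; rewrite exprM.
have sumC1 j : \sum_(c < r.+1) x ^+ (j * c) * (0 < c)%N%:R = part_weight r (x ^+ j) - 1.
  rewrite -sumC !big_ord_recl /= muln0 expr0 mulr0 add0r addrAC subrr add0r.
  by apply: eq_bigr => c _; rewrite mulr1.
have -> : \prod_(i < n.+1) \sum_j F i j = \prod_(1 <= j < n.+2) part_weight r (x ^+ j) *
  \prod_(1 <= j < k | (j.*2 < k)%N)
     (1 - (1 - l) * (1 - (part_weight r (x ^+ j))^-1) * (1 - (part_weight r (x ^+ (k - j)))^-1)).
  rewrite (@prod_pairs _ _ k); last by lia.
  rewrite [X in _ * X]big_mkcond /=.
  rewrite [X in _ * X](_ : _ = \prod_(1 <= j < n.+2) (if (j.*2 < k)%N then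
     (1 - (1 - l) * (1 - (part_weight r (x ^+ j))^-1) * (1 - (part_weight r (x ^+ (k - j)))^-1)) else 1)); last first.
    rewrite [RHS](@big_cat_nat _ _ _ k) //=; last by lia.
    rewrite [X in _ * X]big1_seq ?mulr1 // => j /andP[_]; rewrite mem_index_iota => /andP[kj _].
    by case: ifP => //; lia.
  rewrite -big_split /= -prod_ord_parts; apply: eq_bigr => i _.
  rewrite -(pair_bigA _ (fun c d => F i (c, d))) /= /F -/(low i.+1) -/(high i.+1).
  have [_|_] := boolP (low i.+1).
    set b := (k - i.+1)%N; have gi := g1 i.+1; have gb := g1 b.
    (* Weight [l] instead of 1 where both multiplicities are positive removes [1 - l] times the
       total weight of those configurations. *)
    transitivity (part_weight r (x ^+ i.+1) * part_weight r (x ^+ b) -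
        (1 - l) * ((part_weight r (x ^+ i.+1) - 1) * (part_weight r (x ^+ b) - 1))).
      rewrite -!sumC1 -!sumC !mulr_suml mulr_sumr -sumrB; apply: eq_bigr => c _.
      rewrite !mulr_sumr -sumrB; apply: eq_bigr => d _ /=.
      by case: (0 < c)%N; case: (0 < d)%N => /=; ring.
    by field; rewrite !gt_eqF //; apply: lt_le_trans gi || apply: lt_le_trans gb.
  rewrite mulr1; have [_|_] := boolP (high i.+1).
    rewrite (bigD1 ord0) //= (bigD1 ord0) //= [X in _ + X + _]big1 => [|d /negbTE ->] //.
    by rewrite big1 ?addr0 // => c /negbTE c0; rewrite big1 // => d _; rewrite c0.
  rewrite -sumC; apply: eq_bigr => c _; rewrite (bigD1 ord0) //= mulr1 big1 ?addr0 //.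
  by move=> d /negbTE ->; rewrite mulr0.
have cntE s j : s \in restricted r n -> (inord (count_mem j (parts s)) : 'I_r.+1) = count_mem j (parts s) :> nat.
  by move=> sP; rewrite inordK // ltnS (count_mem_restricted _ sP).
apply.
- move=> s t sA tA st.
  have sP : s \in restricted r n by move: sA; rewrite inE => /andP[].
  have tP : t \in restricted r n by move: tA; rewrite inE => /andP[].
  apply: (mult_vec_inj sP tP); apply/ffunP => i; rewrite !ffunE.
  have [hi|hi] := boolP (high i.+1); last first.
    by have := congr1 (fun g : {ffun _ -> _} => (g i).1) st; rewrite !ffunE /= (negbTE hi); case: ifP.
  have i'n : ((k - i.+1).-1 < n.+1)%N by lia.
  have lowi : low (k - i.+1)%N by move: hi; rewrite /low /high; lia.
  have := congr1 (fun g : {ffun _ -> _} => (g (Ordinal i'n)).2) st; rewrite !ffunE /= prednK; last by move: hi; rewrite /high; lia.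
  by rewrite lowi /=; rewrite subKn //; move: hi; rewrite /high; lia.
- by move=> v; apply: divr_ge0; [apply: prodr_ge0|exact: ltW].
move=> s; rewrite inE => /andP[sP sM]; rewrite ler_pdivlMr // mul1r.
have -> : \prod_i F i (f s i) = \prod_(1 <= j < n.+2) a (parts s) j *
  \prod_(1 <= j < n.+2) (if [&& low j, j \in parts s & (k - j)%N \in parts s] then l else 1).
  rewrite (@prod_pairs _ _ k); last by lia.
  rewrite -big_split /= -prod_ord_parts; apply: eq_bigr => i _.
  rewrite /F ffunE /= -/(low i.+1) -/(high i.+1).
  have [_|_] := boolP (low i.+1).
    by rewrite /= !cntE // -!has_count !has_pred1.
  by have [_|_] := boolP (high i.+1); rewrite /= ?cntE // ?eqxx !mulr1.
rewrite prod_parts // ler_pM2l ?exprn_gt0 //.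
rewrite (@big_cat_nat _ _ _ k.+1) //= [X in _ * X]big1_seq ?mulr1; last first.
  by move=> j /andP[_]; rewrite mem_index_iota /low => /andP[wj _]; case: ifP => //; lia.
rewrite (_ : \prod_(1 <= j < k.+1) _ = l ^+ pair_count (parts s) k).
  by apply: ler_wiXn2l => //; exact: ltW.
by rewrite /pair_count expr_count /index_iota subn1.
Qed.

End Chernoff.

(** * Generating functions *)

(** The Taylor polynomial of degree [M] of [- ln (1 - y)]. *)
Definition log_sum (R : realType) (M : nat) (y : R) : R :=
  \sum_(m < M) y ^+ m.+1 / m.+1%:R.

Lemma is_derive_log_sum (R : realType) (M : nat) (y : R) :
  is_derive y 1 (log_sum M) (\sum_(m < M) y ^+ m).
Proof.
rewrite /log_sum; elim: M => [|M IHM].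
  rewrite (_ : (fun y => _) = cst 0) ?big_ord0; first exact: is_derive_cst.
  by apply/funext => z; rewrite big_ord0.
rewrite (_ : (fun y => _) = (fun y => \sum_(m < M) y ^+ m.+1 / m.+1%:R) + (fun y => y ^+ M.+1 / M.+1%:R)); last first.
  by apply/funext => z; rewrite big_ord_recr.
rewrite big_ord_recr /=.
apply: is_deriveD.
rewrite (_ : (fun y => y ^+ M.+1 / M.+1%:R) = M.+1%:R^-1 \*: (id ^+ M.+1)); last first.
  by apply/funext => z; rewrite /= mulrC fctE.
apply: is_derive_eq.
by rewrite /GRing.scale /= mulr1 mulKf // pnatr_eq0.
Qed.

Lemma is_derive_1B (R : realType) (y : R) : is_derive y 1 (fun z : R => 1 - z) (-1).
Proof. by apply: is_derive_eq; rewrite add0r mul1r. Qed.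

Lemma is_derive_ln1B (R : realType) (y : R) : y < 1 ->
  is_derive y 1 (fun z => ln (1 - z)) (- (1 - y)^-1).
Proof.
move=> y1.
have l1 : is_derive (1 - y) 1 (@ln R) (1 - y)^-1 by apply: is_derive1_ln; lra.
rewrite -[- _]mulrN1.
exact: (@is_derive1_comp _ (@ln R) (fun z : R => 1 - z) y _ _ l1 (is_derive_1B y)).
Qed.

Lemma ge0_of_derive (R : realType) (h dh : R -> R) (y : R) : 0 <= y < 1 ->
  h 0 = 0 -> (forall z : R, 0 <= z < 1 -> is_derive z 1 h (dh z)) ->
  (forall z : R, 0 <= z < 1 -> 0 <= dh z) -> 0 <= h y.
Proof.
move=> /andP[y0 y1] h0 hd dh0.
have [|| z + hz] := @MVT_segment R h dh 0 y y0.
- by move=> z; rewrite in_itv /= => /andP[z0 zy]; apply: hd; lra.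
- apply: continuous_in_subspaceT => z; rewrite inE /= in_itv /= => /andP[z0 zy].
  have zI : 0 <= z < 1 by lra.
  by have [dz _] := hd z zI; apply/differentiable_continuous/derivable1_diffP.
rewrite in_itv /= => /andP[z0 zy]; move: hz; rewrite h0 !subr0 => ->.
by rewrite mulr_ge0 // dh0; lra.
Qed.

(** The difference vanishes at 0 and has the derivative [z ^+ M / (1 - z)]. *)
Lemma log_sum_le (R : realType) (M : nat) (y : R) : 0 <= y < 1 ->
  log_sum M y <= - ln (1 - y).
Proof.
move=> yI; suff : 0 <= - ln (1 - y) - log_sum M y by lra.
apply: (@ge0_of_derive R (fun z => - ln (1 - z) - log_sum M z)
  (fun z => (1 - z)^-1 - \sum_(m < M) z ^+ m)) yI _ _ _ => [|z zI|z zI].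
- rewrite subr0 ln1 oppr0 sub0r /log_sum big1 ?oppr0 // => m _.
  by rewrite expr0n mul0r.
- have z1 : z < 1 by lra.
  have := is_derive_ln1B z1; have := is_derive_log_sum M z => d1 d2.
  by apply: is_derive_eq; rewrite opprK.
have z1 : 0 < 1 - z by lra.
have := subrX1 z M; move/eqP; rewrite -(inj_eq oppr_inj) => /eqP.
rewrite -mulNr !opprB => E.
rewrite subr_ge0 -[leLHS](mulKf (lt0r_neq0 z1)) -E.
apply: ler_piMr; first by rewrite invr_ge0 ltW.
have : 0 <= z ^+ M by apply: exprn_ge0; lra.
lra.
Qed.

(** Differentiating the remainder term produces [M.+1%:R * z ^+ M / (1 - z)], which covers the
    missing tail [z ^+ M / (1 - z)] of the geometric series. *)
Lemma log_sum_ge (R : realType) (M : nat) (y : R) : 0 <= y < 1 ->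
  - ln (1 - y) <= log_sum M y + y ^+ M.+1 / (1 - y).
Proof.
move=> yI; suff : 0 <= log_sum M y + y ^+ M.+1 / (1 - y) + ln (1 - y) by lra.
apply: (@ge0_of_derive R (fun z => log_sum M z + z ^+ M.+1 / (1 - z) + ln (1 - z))
  (fun z => \sum_(m < M) z ^+ m + (M.+1%:R * z ^+ M / (1 - z) + z ^+ M.+1 * (1 - z) ^- 2) - (1 - z)^-1)) yI _ _ _ => [|z zI|z zI].
- rewrite subr0 ln1 addr0 expr0n mul0r addr0 /log_sum big1 ?oppr0 // => m _.
  by rewrite expr0n mul0r.
- have z1 : z < 1 by lra.
  have d1 := is_derive_ln1B z1; have d2 := is_derive_log_sum M z.
  have d3 := is_derive_1B z.
  have d4 : is_derive z 1 (fun z : R => (1 - z)^-1) ((1 - z) ^- 2).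
    have z1' : 1 - z != 0 by lra.
    have := @is_deriveV R (fun z : R => 1 - z) z (-1) 1 z1' d3.
    by rewrite /GRing.scale /= mulrN1 opprK.
  have d5 : is_derive z 1 (id ^+ M.+1) (M.+1%:R * z ^+ M).
    by apply: is_derive_eq; rewrite /GRing.scale /= mulr1.
  have d6 : is_derive z 1 ((id ^+ M.+1) * (fun z : R => (1 - z)^-1)) (M.+1%:R * z ^+ M / (1 - z) + z ^+ M.+1 * (1 - z) ^- 2).
    apply: is_derive_eq; rewrite /GRing.scale /= addrC; congr (_ + _); first exact: mulrC.
    by rewrite fctE.
  rewrite (_ : (fun z : R => _) = log_sum M + ((id ^+ M.+1) * (fun z : R => (1 - z)^-1)) + (fun z : R => ln (1 - z))).
    exact: is_deriveD (is_deriveD d2 d6) d1.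
  by apply/funext => u; rewrite !fctE.
have z1 : 0 < 1 - z by lra.
have := subrX1 z M; move/eqP; rewrite -(inj_eq oppr_inj) => /eqP.
rewrite -mulNr !opprB => E.
have -> : \sum_(m < M) z ^+ m = (1 - z ^+ M) / (1 - z).
  by rewrite E mulrC mulKf // lt0r_neq0.
have zM : 0 <= z ^+ M by apply: exprn_ge0; lra.
have : 0 <= z ^+ M.+1 * (1 - z) ^- 2.
  by rewrite mulr_ge0 ?exprn_ge0 ?invr_ge0 ?sqr_ge0 //; lra.
have : z ^+ M / (1 - z) <= M.+1%:R * z ^+ M / (1 - z).
  by apply: ler_wpM2r; [rewrite invr_ge0 ltW|rewrite ler_peMl // ler1n].
rewrite mulrBl mul1r; lra.
Qed.

(** * Partial sums of zeta(2) *)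

Definition zeta2_sum (R : realType) (M : nat) : R := \sum_(m < M) (m.+1%:R ^+ 2)^-1.

Lemma zeta2_sum_nondecreasing (R : realType) (M N : nat) : (M <= N)%N -> zeta2_sum R M <= zeta2_sum R N.
Proof.
move=> MN; rewrite -(subnKC MN); elim: (N - M)%N => [|k IHk]; first by rewrite addn0.
by rewrite addnS /zeta2_sum big_ord_recr /=; apply: (le_trans IHk); rewrite lerDl invr_ge0 sqr_ge0.
Qed.

Lemma zeta2_sum_10 (R : realType) : 3 / 2 <= zeta2_sum R 10 /\ zeta2_sum R 10 + 2 / 21 <= 33 / 20.
Proof. by rewrite /zeta2_sum !big_ord_recr big_ord0 /=; split; lra. Qed.

(** By [1 / m^2 <= 1 / (m - 1/2) - 1 / (m + 1/2)] the terms beyond the tenth telescope to at most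
    [1 / (10 + 1/2) = 2 / 21]. *)
Lemma zeta2_sum_bound (R : realType) (M : nat) : zeta2_sum R M <= 33 / 20.
Proof.
have [_ h10] := zeta2_sum_10 R.
suff H k : zeta2_sum R (10 + k) <= zeta2_sum R 10 + 2 / 21 - (k%:R + 21 / 2)^-1.
  have [M10|M10] := leqP M 10.
    by have := zeta2_sum_nondecreasing R M10; lra.
  have := H (M - 10)%N; rewrite subnKC 1?ltnW //.
  have : 0 <= ((M - 10)%:R + 21 / 2 : R)^-1.
    by rewrite invr_ge0; have : 0 <= (M - 10)%:R :> R by []; lra.
  lra.
elim: k => [|k IHk]; first by rewrite addn0 add0r invf_div; lra.
rewrite addnS /zeta2_sum big_ord_recr /= -/(zeta2_sum R 10) -/(zeta2_sum R (10 + k)).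
suff : ((10 + k).+1%:R ^+ 2 : R)^-1 <= (k%:R + 21 / 2)^-1 - (k.+1%:R + 21 / 2)^-1.
  by move=> HH; apply: (le_trans (lerD IHk HH)); rewrite addrA subrK.
have k0 : 0 <= k%:R :> R by [].
have -> : (10 + k).+1%:R = k%:R + 11 :> R by rewrite -addSn natrD addrC.
rewrite -(natr1 k); set z := k%:R in k0 *.
have -> : (z + 21 / 2)^-1 - (z + 1 + 21 / 2)^-1 = ((z + 21 / 2) * (z + 1 + 21 / 2))^-1.
  by field; rewrite !gt_eqF //; lra.
by rewrite lef_pV2 ?posrE ?mulr_gt0 ?exprn_gt0 //; nra.
Qed.

(** [Z] is zeta(2), obtained as the supremum of its partial sums. *)
Lemma zeta2_exists (R : realType) : exists Z : R, [/\ 3 / 2 <= Z <= 33 / 20,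
  forall M, zeta2_sum R M <= Z & forall e, 0 < e -> exists M, Z - e <= zeta2_sum R M].
Proof.
pose S : set R := range (@zeta2_sum R).
have S0 : has_sup S.
  split; first by exists (zeta2_sum R 0); exists 0%N.
  by exists (33 / 20) => _ [M _ <-]; apply: zeta2_sum_bound.
have Sle M : zeta2_sum R M <= sup S by apply: sup_upper_bound => //; exists M.
exists (sup S); split=> //.
  apply/andP; split; first by apply: le_trans (Sle 10); case: (zeta2_sum_10 R).
  by apply: ge_sup; [case: S0|move=> _ [M _ <-]; apply: zeta2_sum_bound].
move=> e e0; have [_ [M _ <-] hM] := sup_adherent e0 S0.
by exists M; exact: ltW.
Qed.

(** * Growth of the generating functions as t tends to 0 *)

(** Logarithm of the generating function of the partitions into parts at most [N], taken at
    [exp(-t)]. *)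
Definition log_partition_gf (R : realType) (N : nat) (t : R) : R :=
  \sum_(1 <= j < N.+1) - ln (1 - expR (- (t * j%:R))).

Lemma expRN_bounds (R : realType) (u : R) : 0 < u -> 0 <= expR (- u) < 1.
Proof. by move=> u0; rewrite expR_ge0 expR_lt1 oppr_lt0. Qed.

Lemma sum_log_sum (R : realType) (N M : nat) (t : R) :
  \sum_(1 <= j < N.+1) log_sum M (expR (- (t * j%:R))) =
  \sum_(m < M) (\sum_(1 <= j < N.+1) expR (- (t * m.+1%:R)) ^+ j) / m.+1%:R.
Proof.
rewrite /log_sum exchange_big /=; apply: eq_bigr => m _.
rewrite mulr_suml; apply: eq_bigr => j _; congr (_ / _).
by rewrite -!expRM_natr; congr expR; ring.
Qed.

Lemma geom_sum (R : realType) (N : nat) (y : R) : y != 1 ->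
  \sum_(1 <= j < N.+1) y ^+ j = (1 - y ^+ N) * (y / (1 - y)).
Proof.
move=> y1; have y1' : 1 - y != 0 by rewrite subr_eq0 eq_sym.
elim: N => [|N IHN]; first by rewrite big_geq // expr0 subrr mul0r.
by rewrite big_nat_recr //= IHN exprS; field.
Qed.

(** The ratio is [1 / (exp u - 1)]; the two bounds are [exp v >= 1 + v] at [v = -u] and at
    [v = u]. *)
Lemma expRN_ratio (R : realType) (u : R) : 0 < u ->
  u^-1 - 1 <= expR (- u) / (1 - expR (- u)) <= u^-1.
Proof.
move=> u0; have /andP[_ e1] := expRN_bounds u0.
have e0 := expR_gt0 (- u); have := expR_ge1Dx (- u).
have : 1 + u <= expR u by apply: expR_ge1Dx.
have : expR u * expR (- u) = 1 by rewrite expRxMexpNx_1.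
set e := expR (- u) in e0 e1 *; set f := expR u => ef fu eu.
have e1' : 0 < 1 - e by lra.
have v0 : 0 < u^-1 by rewrite invr_gt0.
have uv : u * u^-1 = 1 by rewrite divff // gt_eqF.
set v := u^-1 in v0 uv *.
have h1 : 0 <= v * (e + u - 1) by apply: mulr_ge0; [exact: ltW|lra].
have hv2 : 0 <= v * (e * (f - 1 - u)).
  by apply: mulr_ge0; [exact: ltW|apply: mulr_ge0; [exact: ltW|lra]].
apply/andP; split; [rewrite ler_pdivlMr //|rewrite ler_pdivrMr //].
  have : v * (e + u - 1) = v * e + u * v - v by ring.
  by rewrite uv; lra.
have : v * (e * (f - 1 - u)) = v * (f * e) - v * e - (u * v) * e by ring.
by rewrite uv ef; lra.
Qed.

Lemma log_partition_gf_ge0 (R : realType) N (t : R) : 0 < t -> 0 <= log_partition_gf N t.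
Proof.
move=> t0; rewrite /log_partition_gf big_add1 /= big_mkord; apply: sumr_ge0 => j _.
rewrite oppr_ge0 ln_le0 // gerBl expR_ge0 //.
Qed.

(** Expanding the logarithms gives the sum over [m] of [1 / m] times the sum over [j] of
    [exp(- t m j)]. The inner sums are at most [1 / (t m)], whence [Z / t], for all [N] and [t]. The
    expansion is cut at an [M] depending on [N] and [t]. *)
Lemma log_partition_gf_le (R : realType) (Z t : R) (N : nat) : (forall M, zeta2_sum R M <= Z) ->
  0 < t -> log_partition_gf N t <= Z / t.
Proof.
move=> hZ t0; apply/ler_addgt0Pr => e e0.
set x := expR (- t).
have /andP[_ x1] := expRN_bounds t0.
have x1' : 0 < 1 - x by rewrite subr_gt0.
(* [c / M.+1%:R] bounds the sum of the [N] remainders, by [x ^+ M.+1 <= 1 / (t * M.+1%:R)]. *)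
pose c : R := N%:R / (t * (1 - x)).
have c0 : 0 <= c by rewrite divr_ge0 // mulr_ge0 // ltW.
have [M hM] : exists M : nat, c / e <= M%:R.
  by exists (Num.truncn (c / e)).+1; apply: ltW; exact: truncnS_gt.
have jI j : (1 <= j)%N -> 0 <= expR (- (t * j%:R)) < (1 : R).
  by move=> j1; apply: expRN_bounds; rewrite mulr_gt0 // ltr0n.
apply: (@le_trans _ _ (\sum_(1 <= j < N.+1) (log_sum M (expR (- (t * j%:R))) +
   expR (- (t * j%:R)) ^+ M.+1 / (1 - expR (- (t * j%:R)))))).
  rewrite /log_partition_gf !big_nat; apply: ler_sum => j /andP[j1 _].
  exact/log_sum_ge/jI.
rewrite big_split /=; apply: lerD.
  rewrite sum_log_sum; apply: le_trans (_ : zeta2_sum R M / t <= _); last first.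
    by rewrite ler_wpM2r // invr_ge0 ltW.
  rewrite /zeta2_sum mulr_suml; apply: ler_sum => m _.
  have m0 : 0 < m.+1%:R :> R by rewrite ltr0n.
  have tm0 : 0 < t * m.+1%:R by rewrite mulr_gt0.
  have /andP[y0 y1] := expRN_bounds tm0.
  rewrite geom_sum ?lt_eqF // ler_pdivrMr //.
  have /andP[_ H] := expRN_ratio tm0.
  apply: le_trans (ler_piMl _ _) _.
  - by rewrite divr_ge0 // subr_ge0 ltW.
  - by rewrite gerBl exprn_ge0.
  by apply: (le_trans H); rewrite le_eqVlt; apply/orP; left; apply/eqP; field; rewrite !gt_eqF.
apply: (@le_trans _ _ (\sum_(1 <= j < N.+1) c / N%:R / M.+1%:R)); last first.
  rewrite sumr_const_nat subn1 /=.
  have [->|N0] := eqVneq N 0%N; first by rewrite mulr0n ltW.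
  have -> : c / N%:R / M.+1%:R *+ N = c / M.+1%:R.
    by rewrite -mulr_natr mulrAC divfK ?pnatr_eq0.
  rewrite ler_pdivrMr ?ltr0n // -ler_pdivrMl //.
  by rewrite mulrC (le_trans hM) // ler_nat.
rewrite !big_nat; apply: ler_sum => j /andP[j1 jN].
have N0 : N%:R != 0 :> R by rewrite pnatr_eq0; lia.
have -> : c / N%:R = t^-1 / (1 - x).
  by rewrite /c; field; rewrite N0 !gt_eqF //.
rewrite -mulrA [X in _ <= _ * X]mulrC mulrA -[t^-1 / _]mulrC.
have xj : expR (- (t * j%:R)) <= x by rewrite ler_expR lerN2 ler_peMr ?ler1n // ltW.
have /andP[xj0 xj1] := jI j j1.
apply: ler_pM.
- exact: exprn_ge0.
- by rewrite invr_ge0 subr_ge0 ltW.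
- apply: le_trans (_ : x ^+ M.+1 <= _); first by rewrite lerXn2r ?nnegrE ?expR_ge0.
  rewrite /x -expRM_natr mulNr expRN -invfM lef_pV2 ?posrE ?mulr_gt0 ?expR_gt0 // ?ltr0n //.
  by have := expR_ge1Dx (t * M.+1%:R); lra.
by rewrite lef_pV2 ?posrE ?subr_gt0 // lerD2l lerN2.
Qed.

(** For a fixed [M] each of the [M] inner sums loses twice: [1 / (exp u - 1)] falls short of [1 / u]
    by at most 1, and stopping at [N] costs a factor [1 - exp(- t m N)], at least [1 - 1 / K]. *)
Lemma log_partition_gf_ge (R : realType) (Z e : R) : 0 <= Z -> 0 < e ->
  (forall M, zeta2_sum R M <= Z) -> (forall e, 0 < e -> exists M, Z - e <= zeta2_sum R M) ->
  exists2 K : R, 0 < K & forall (t : R) (N : nat),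
    0 < t -> t * K <= 1 -> K <= t * N%:R -> (Z - e) / t <= log_partition_gf N t.
Proof.
move=> Z0 e0 hZ approx.
have [|M hM] := approx (e / 2); first by rewrite divr_gt0.
have M0 : 0 <= M%:R :> R by [].
(* [1 + M] ensures [t * M <= 1]; the last summand makes [(M + Z) / K] at most [e / 2], the other
   half of [e] being spent on approximating [Z]. *)
pose K := 1 + M%:R + 2 * (M%:R + Z) / e.
have c0 : 0 <= 2 * (M%:R + Z) / e by rewrite divr_ge0 ?mulr_ge0 ?addr_ge0 // ltW.
have K0 : 0 < K by rewrite /K; lra.
exists K => // t N t0 tK KN.
have Ki0 : 0 < K^-1 by rewrite invr_gt0.
have KK : K * K^-1 = 1 by rewrite divff // gt_eqF.
have tKi : t <= K^-1 by rewrite -div1r ler_pdivlMr.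
have K1 : 0 <= 1 - K^-1 by rewrite subr_ge0 invf_le1 // /K; lra.
have tM : t * M%:R <= 1.
  by apply: le_trans tK; rewrite ler_wpM2l ?ltW // /K; lra.
apply: (@le_trans _ _ (\sum_(1 <= j < N.+1) log_sum M (expR (- (t * j%:R))))); last first.
  rewrite /log_partition_gf !big_nat; apply: ler_sum => j /andP[j1 _].
  by apply/log_sum_le/expRN_bounds; rewrite mulr_gt0 // ltr0n.
rewrite sum_log_sum.
apply: (@le_trans _ _ ((1 - K^-1) * (zeta2_sum R M / t - M%:R))).
  rewrite ler_pdivrMr //.
  have -> : (1 - K^-1) * (zeta2_sum R M / t - M%:R) * t = (1 - K^-1) * (zeta2_sum R M - M%:R * t).
    by field; rewrite !gt_eqF.
  have tM' : M%:R * t <= M%:R * K^-1 by rewrite ler_wpM2l.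
  have : K^-1 * (zeta2_sum R M - M%:R * t) <= K^-1 * Z.
    rewrite ler_wpM2l ?(ltW Ki0) //.
    have Mt0 : 0 <= M%:R * t by rewrite mulr_ge0 // ltW.
    by have := hZ M; lra.
  have : (M%:R + Z) * K^-1 <= e / 2.
    rewrite ler_pdivrMr // /K mulrDr; have : e / 2 * (2 * (M%:R + Z) / e) = M%:R + Z.
      by field; rewrite gt_eqF.
    have : 0 <= e / 2 * (1 + M%:R) by rewrite mulr_ge0 //; lra.
    lra.
  rewrite mulrBl mul1r mulrDl [Z * _]mulrC; lra.
have -> : (1 - K^-1) * (zeta2_sum R M / t - M%:R) =
    \sum_(m < M) (1 - K^-1) * ((m.+1%:R ^+ 2)^-1 / t - 1).
  by rewrite -mulr_sumr sumrB -mulr_suml sumr_const card_ord.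
apply: ler_sum => m _.
have m1 : 1 <= m.+1%:R :> R by rewrite ler1n.
have m0 : 0 < m.+1%:R :> R by rewrite ltr0n.
have mM : m.+1%:R <= M%:R :> R by rewrite ler_nat.
have tm0 : 0 < t * m.+1%:R by rewrite mulr_gt0.
have /andP[y0 y1] := expRN_bounds tm0.
have /andP[H _] := expRN_ratio tm0.
rewrite geom_sum ?lt_eqF // ler_pdivlMr //.
have tm1 : 0 <= (t * m.+1%:R)^-1 - 1.
  rewrite subr_ge0 invf_ge1 //; apply: le_trans tM.
  by rewrite ler_wpM2l // ltW.
apply: (@le_trans _ _ ((1 - K^-1) * ((t * m.+1%:R)^-1 - 1))).
  rewrite -mulrA ler_wpM2l // mulrBl mul1r; apply: lerB => //.
  by rewrite le_eqVlt; apply/orP; left; apply/eqP; field; rewrite !gt_eqF.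
apply: ler_pM => //.
rewrite lerD2l lerN2 -expRM_natr mulNr expRN lef_pV2 ?posrE ?expR_gt0 //.
apply: le_trans KN _; apply: (@le_trans _ _ (t * m.+1%:R * N%:R)).
  by rewrite mulrAC ler_peMr // mulr_ge0 // ltW.
by have := expR_ge1Dx (t * m.+1%:R * N%:R); lra.
Qed.

Lemma part_weight_geom (R : realFieldType) (r : nat) (x : R) : x != 1 ->
  part_weight r x = (1 - x ^+ r.+1) / (1 - x).
Proof.
move=> x1; apply/(canRL (mulfK _)); first by rewrite subr_eq0 eq_sym.
have := subrX1 x r.+1 => E; rewrite /part_weight -[RHS]opprB E; ring.
Qed.

Definition restricted_gf (R : realType) (r N : nat) (t : R) : R :=
  \prod_(1 <= j < N.+1) part_weight r (expR (- t) ^+ j).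

Lemma restricted_gf_gt0 (R : realType) (r N : nat) (t : R) : 0 < restricted_gf r N t.
Proof.
rewrite /restricted_gf big_nat; apply: prodr_gt0 => j _.
rewrite /part_weight big_ord_recl expr0 ltr_pwDl //; apply: sumr_ge0 => i _.
by rewrite !exprn_ge0 // expR_ge0.
Qed.

(** Each factor is [(1 - y^(r+1)) / (1 - y)] with [y = exp(- t j)], and [y^(r+1)] belongs to the
    parameter [(r + 1) * t]. The main terms [Z / t - Z / ((r + 1) * t)] then give the constant
    [Z * r / (r + 1)]. *)
Lemma restricted_gfE (R : realType) (r N : nat) (t : R) : 0 < t ->
  restricted_gf r N t = expR (log_partition_gf N t - log_partition_gf N (r.+1%:R * t)).
Proof.
move=> t0; rewrite /log_partition_gf -sumrB -[LHS]lnK ?posrE ?restricted_gf_gt0 //; congr expR.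
have gw0 j : 0 < part_weight r (expR (- t) ^+ j).
  rewrite /part_weight big_ord_recl expr0 ltr_pwDl //; apply: sumr_ge0 => i _.
  by rewrite !exprn_ge0 // expR_ge0.
have -> : ln (restricted_gf r N t) = \sum_(1 <= j < N.+1) ln (part_weight r (expR (- t) ^+ j)).
  rewrite /restricted_gf; elim: (index_iota _ _) => [|j s IHs]; first by rewrite !big_nil ln1.
  rewrite !big_cons lnM ?posrE ?IHs //.
  by rewrite big_seq; apply: prodr_gt0 => i _.
rewrite !big_nat; apply: eq_bigr => j /andP[j1 _].
have j0 : 0 < j%:R :> R by rewrite ltr0n.
have tj0 : 0 < t * j%:R by rewrite mulr_gt0.
have rtj0 : 0 < r.+1%:R * t * j%:R by rewrite !mulr_gt0 // ltr0n.
have /andP[_ y1] := expRN_bounds tj0; have /andP[_ y1'] := expRN_bounds rtj0.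
have -> : expR (- t) ^+ j = expR (- (t * j%:R)) by rewrite -expRM_natr mulNr.
rewrite part_weight_geom ?lt_eqF // -expRM_natr.
rewrite (_ : - (t * j%:R) * r.+1%:R = - (r.+1%:R * t * j%:R)); last by ring.
by rewrite ln_div ?posrE ?subr_gt0 // opprK addrC.
Qed.

(* [log restricted_gf ~ B / t], uniformly for [t -> 0] and [t * N -> oo]. *)
Definition restricted_gf_asymp (R : realType) (B : R) (r_ : nat -> nat) :=
  forall e : R, 0 < e -> exists2 K : R, 0 < K & forall (t : R) (N : nat),
    0 < t -> t * K <= 1 -> K <= t * N%:R ->
    expR ((B - e) / t) <= restricted_gf (r_ N) N t <= expR ((B + e) / t).

Definition is_zeta2 (R : realType) (Z : R) :=
  [/\ 0 <= Z, forall M, zeta2_sum R M <= Z & forall e, 0 < e -> exists M, Z - e <= zeta2_sum R M].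

Lemma restricted_gf_asymp_fixed (R : realType) (Z : R) (r : nat) : is_zeta2 Z ->
  restricted_gf_asymp (Z * (r%:R / r.+1%:R)) (fun=> r).
Proof.
move=> [Z0 hZ approx] e e0.
have [K K0 HK] := log_partition_gf_ge Z0 e0 hZ approx.
have r1 : 1 <= r.+1%:R :> R by rewrite ler1n.
have r0 : 0 < r.+1%:R :> R by rewrite ltr0n.
exists (r.+1%:R * K); first by rewrite mulr_gt0.
move=> t N t0 tK KN; have rt0 : 0 < r.+1%:R * t by rewrite mulr_gt0.
have KrK : K <= r.+1%:R * K by rewrite ler_peMl // ltW.
have tr : t <= r.+1%:R * t by rewrite ler_peMl // ltW.
have l1 := HK t N t0 (le_trans (ler_wpM2l (ltW t0) KrK) tK) (le_trans KrK KN).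
have u1 := log_partition_gf_le N hZ t0; have u2 := log_partition_gf_le N hZ rt0.
have l2 : (Z - e) / (r.+1%:R * t) <= log_partition_gf N (r.+1%:R * t).
  apply: HK => //; first by rewrite mulrC mulrA mulrC [K * _]mulrC.
  by apply: (le_trans KrK); apply: (le_trans KN); rewrite ler_wpM2r.
rewrite restricted_gfE // !ler_expR.
have rE : r%:R = r.+1%:R - 1 :> R by rewrite -natr1 addrK.
have E1 : (Z * (r%:R / r.+1%:R) - e) / t = (Z - e) / t - Z / (r.+1%:R * t).
  by rewrite rE; field; rewrite !gt_eqF.
have E2 : (Z * (r%:R / r.+1%:R) + e) / t = Z / t - (Z - e) / (r.+1%:R * t) + e / t * (1 - r.+1%:R^-1).
  by rewrite rE; field; rewrite !gt_eqF.
rewrite E1 E2; have : 0 <= e / t * (1 - r.+1%:R^-1).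
  by rewrite mulr_ge0 ?divr_ge0 ?subr_ge0 ?invf_le1 // ltW.
by move=> c0; apply/andP; split; [exact: lerB|apply: le_trans (lerB u1 l2) _; rewrite lerDl].
Qed.

(** A partition of a number up to [N] repeats no part more than [N] times, so this case serves for
    [p]. The correction [Z / ((N + 1) * t)] is at most [e / (2 * t)] once [N + 1 >= 2 * Z / e]. *)
Lemma restricted_gf_asymp_id (R : realType) (Z : R) : is_zeta2 Z -> restricted_gf_asymp Z id.
Proof.
move=> [Z0 hZ approx] e e0; have e20 : 0 < e / 2 by rewrite divr_gt0.
have [K K0 HK] := log_partition_gf_ge Z0 e20 hZ approx.
have Ze0 : 0 <= 2 * Z / e by rewrite divr_ge0 ?mulr_ge0 // ltW.
exists (1 + K + 2 * Z / e); first by lra.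
move=> t N t0 tK KN.
have t1 : t <= 1.
  by apply: le_trans tK; rewrite ler_peMr ?ltW //; lra.
have NK : 2 * Z / e <= N.+1%:R.
  rewrite -natr1; have : t * N%:R <= N%:R by rewrite ler_piMl.
  lra.
have N0 : 0 < N.+1%:R :> R by rewrite ltr0n.
have Nt0 : 0 < N.+1%:R * t by rewrite mulr_gt0.
have l1 : (Z - e / 2) / t <= log_partition_gf N t.
  apply: HK => //; last by lra.
  by apply: le_trans tK; rewrite ler_wpM2l ?ltW //; lra.
have u1 := log_partition_gf_le N hZ t0; have u2 := log_partition_gf_le N hZ Nt0.
have l2 := @log_partition_gf_ge0 R N _ Nt0.
rewrite restricted_gfE // !ler_expR.
have : Z / (N.+1%:R * t) <= (e / 2) / t.
  rewrite invfM mulrA; apply: ler_wpM2r; first by rewrite invr_ge0 ltW.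
  by rewrite ler_pdivrMr //; move: NK; rewrite ler_pdivrMr //; lra.
move=> H1; have et0 : 0 <= e / t by rewrite divr_ge0 ?ltW.
have -> : (Z - e) / t = (Z - e / 2) / t - e / 2 / t by field; rewrite gt_eqF.
apply/andP; split; first by apply: lerB => //; apply: le_trans H1.
apply: le_trans (lerB u1 l2) _; rewrite subr0 mulrDl; lra.
Qed.

(** * Lower bounds for p and q by localization at the saddle point *)

Lemma sum_expR_mult_sum (R : realType) (r n : nat) (t : R) :
  \sum_(v : {ffun 'I_n -> 'I_r.+1}) expR (- (t * (mult_sum v)%:R)) = restricted_gf r n t.
Proof.
rewrite /restricted_gf -prod_ord_parts /part_weight bigA_distr_bigA; apply: eq_bigr => v _.
rewrite -mulNr expRM_natr /mult_sum -prodrXr; apply: eq_bigr => i _.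
by rewrite exprM.
Qed.

(* The tails are moved to the parameters [t * (1 + h)] and [t * (1 - h)]; [a] and [n]
   lie on both sides of the saddle point [B / t ^+ 2]. *)
Lemma restricted_gf_split (R : realType) (r n Q : nat) (t h a : R) :
  (forall m, (0 < m <= n)%N ->
    (#|[set v : {ffun 'I_n -> 'I_r.+1} | mult_sum v == m]| <= Q)%N) ->
  0 < t -> 0 <= h -> 0 <= a ->
  restricted_gf r n t <= expR (h * t * a) * restricted_gf r n (t * (1 + h)) +
    (n * Q)%:R * expR (- (t * a)) +
    expR (- (h * t * n%:R)) * restricted_gf r n (t * (1 - h)).
Proof.
move=> hQ t0 h0 a0; rewrite -!sum_expR_mult_sum.
have cardE : \sum_(v : {ffun 'I_n -> 'I_r.+1} | (0 < mult_sum v <= n)%N) (1 : R) <= (n * Q)%:R.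
  rewrite sumr_const ler_nat.
  rewrite -sum1_card (partition_big (fun v => inord (mult_sum v) : 'I_n.+1) (fun i => (0 < i)%N)) /=; last first.
    by move=> v /andP[v0 vn]; rewrite inordK.
  apply: (@leq_trans (\sum_(i < n.+1 | (0 < i)%N) Q)).
    apply: leq_sum => i i0; rewrite sum1_card; apply: leq_trans (hQ i _); last first.
      by rewrite i0 -ltnS /=.
    apply: subset_leq_card; apply/fintype.subsetP => v; rewrite !inE => /andP[/andP[v0 vn] /eqP vi].
    by rewrite -vi inordK.
  by rewrite big_mkcond big_ord_recl /= add0n sum_nat_const card_ord.
apply: le_trans (lerD (lerD (lexx _) (ler_wpM2r (expR_ge0 _) cardE)) (lexx _)).
rewrite mulr_suml [X in _ + X + _]big_mkcond /= !mulr_sumr -!big_split /=.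
apply: ler_sum => v _; set s := mult_sum v.
rewrite -!expRD; have s0 : 0 <= s%:R :> R by [].
have p1 := expR_ge0 (h * t * a + - (t * (1 + h) * s%:R)).
set q := (if _ then _ else _ : R).
have qE : (0 < s <= n)%N -> q = expR (- (t * a)) by rewrite /q => ->; rewrite mul1r.
have p2 : 0 <= q by rewrite /q; case: ifP; rewrite // mul1r expR_ge0.
clearbody q.
have p3 := expR_ge0 (- (h * t * n%:R) + - (t * (1 - h) * s%:R)).
have [sa|sa] := leP (s%:R : R) a.
  have : expR (- (t * s%:R)) <= expR (h * t * a + - (t * (1 + h) * s%:R)).
    rewrite ler_expR -subr_ge0.
    rewrite (_ : _ - _ = h * t * (a - s%:R)); last by ring.
    by rewrite !mulr_ge0 ?subr_ge0 // ltW.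
  lra.
have [sn|sn] := leqP s n.
  have s00 : (0 < s)%N by rewrite lt0n; apply: contraTneq sa => ->; rewrite -leNgt.
  have : expR (- (t * s%:R)) <= expR (- (t * a)).
    by rewrite ler_expR lerN2 ler_wpM2l // ltW.
  rewrite qE ?s00 //; lra.
have : expR (- (t * s%:R)) <= expR (- (h * t * n%:R) + - (t * (1 - h) * s%:R)).
  rewrite ler_expR -subr_ge0.
  have -> : - (h * t * n%:R) + - (t * (1 - h) * s%:R) - - (t * s%:R) = h * t * (s%:R - n%:R).
    by ring.
  apply: mulr_ge0; first by apply: mulr_ge0 => //; exact: ltW.
  by rewrite subr_ge0 ler_nat ltnW.
lra.
Qed.

Lemma sqrt_nat_large (R : realType) (C : R) :
  exists N : nat, forall n : nat, (N <= n)%N -> C <= Num.sqrt (n%:R : R).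
Proof.
exists (Num.truncn (C ^+ 2)).+1 => n Nn.
apply: le_trans (ler_norm C) _; rewrite -sqrtr_sqr ler_sqrt ?ler0n //.
apply: (@le_trans _ _ (Num.truncn (C ^+ 2)).+1%:R); last by rewrite ler_nat.
by apply: ltW; exact: truncnS_gt.
Qed.

(** The cubic term [(d * s)^3 / 6] of the exponential series already reaches [s^2]. This absorbs
    factors polynomial in [n = s^2]. *)
Lemma sqr_le_expR (R : realType) (d s : R) : 0 < d -> 6 / d ^+ 3 <= s ->
  s ^+ 2 <= expR (d * s).
Proof.
move=> d0; rewrite ler_pdivrMr ?exprn_gt0 // => ds.
have s0 : 0 < s.
  by rewrite -(pmulr_lgt0 _ (exprn_gt0 3 d0)); apply: lt_le_trans ds.
have := @expR_ge1Dxn R (d * s) 2; rewrite (_ : 3`!%:R = 6%:R) // => /(_ (mulr_ge0 (ltW d0) (ltW s0))).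
apply: le_trans; apply: (@le_trans _ _ ((d * s) ^+ 3 / 6)); last by lra.
rewrite ler_pdivlMr // exprMn exprS; have s20 : 0 <= s ^+ 2 by exact: sqr_ge0.
nra.
Qed.

(** The left side is [t] times the exponent of the tail below [a = (1 - 2h) B / t^2], estimated at
    [t (1 + h)] with an error [h^2 B / 4] in the asymptotics. The tilt gains [h^2 B], of which [3/4]
    survives the error. In [peak_high] the tail lies above [n = (1 + 4h) B / t^2] and is estimated
    at [t (1 - h)]. *)
Lemma peak_low (R : realFieldType) (h B : R) : 0 < h -> 0 <= B ->
  h * ((1 - 2 * h) * B) + (B + h ^+ 2 * B / 4) / (1 + h) <= B - 3 / 4 * h ^+ 2 * B.
Proof.
move=> h0 B0; have : (B + h ^+ 2 * B / 4) / (1 + h) <= B * (1 - h + 5 / 4 * h ^+ 2).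
  rewrite ler_pdivrMr; last by lra.
  have : 0 <= h ^+ 2 * B * h by rewrite !mulr_ge0 ?sqr_ge0 // ltW.
  lra.
lra.
Qed.

Lemma peak_high (R : realFieldType) (h B : R) : 0 < h <= 1 / 2 -> 0 <= B ->
  - (h * ((1 + 4 * h) * B)) + (B + h ^+ 2 * B / 4) / (1 - h) <= B - 3 / 4 * h ^+ 2 * B.
Proof.
move=> /andP[h0 h1] B0; have hB : 0 <= h ^+ 2 * B by rewrite mulr_ge0 ?sqr_ge0.
have : (B + h ^+ 2 * B / 4) / (1 - h) <= B * (1 + h + 13 / 4 * h ^+ 2).
  rewrite ler_pdivrMr; last by lra.
  have : 0 <= h ^+ 2 * B * (1 / 2 - h) by apply: mulr_ge0; [exact: mulr_ge0 (sqr_ge0 _) B0|lra].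
  lra.
lra.
Qed.

(** In units of [B / t] the right side is the exponent obtained for [n * Q n], and
    [w = sqrt (1 + 4h)] is the value of [sqrt (B n)]; this is the price of placing [n] beyond the
    saddle point. *)
Lemma peak_value (R : realFieldType) (h w : R) : 0 < h <= 1 / 2 -> 0 <= w <= 1 + 2 * h ->
  (2 - 7 * h) * w <= 2 - 2 * h - 3 / 4 * h ^+ 2.
Proof.
move=> /andP[h0 h1] /andP[w0 wh].
have hh : h * h <= 1 / 2 * (1 / 2) by exact: (ler_pM (ltW h0) (ltW h0) h1 h1).
have [h7|h7] := leP (2 - 7 * h) 0.
  apply: (@le_trans _ _ 0); first by rewrite mulr_le0_ge0.
  rewrite expr2; lra.
apply: le_trans (ler_wpM2l (ltW h7) wh) _.
have := sqr_ge0 h; lra.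
Qed.

(** Near [t = (B / n)^(1/2)] the generating function cannot live on its tails, so the sums between
    [a] and [n], each attained by at most [Q n] vectors, carry nearly its whole exponent;
    [n * Q n * exp(- t a)] is then large. *)
Lemma partition_lower (R : realType) (B : R) (r_ Q : nat -> nat) : 0 < B ->
  restricted_gf_asymp B r_ ->
  (forall n m, (0 < m <= n)%N ->
    (#|[set v : {ffun 'I_n -> 'I_(r_ n).+1} | mult_sum v == m]| <= Q n)%N) ->
  forall e : R, 0 < e -> exists N : nat, forall n : nat, (N <= n)%N ->
    expR ((2 * Num.sqrt B - e) * Num.sqrt n%:R) <= (Q n)%:R.
Proof.
move=> B0 asym hQ e e0.
set b := Num.sqrt B; have b0 : 0 < b by rewrite sqrtr_gt0.
have bB : b ^+ 2 = B by rewrite sqr_sqrtr // ltW.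
(* Chosen so that both [7 * h * b <= e / 2] and [h <= 1 / 2]. *)
pose h := e / (14 * b + 2 * e).
have hd : 0 < 14 * b + 2 * e by lra.
have h0 : 0 < h by rewrite divr_gt0.
have hh : h * (14 * b + 2 * e) = e by rewrite divfK // gt_eqF.
have h1 : h <= 1 / 2.
  by rewrite /h ler_pdivrMr //; lra.
have hI : 0 < h <= 1 / 2 by rewrite h0.
have hb : 7 * h * b <= e / 2.
  have : 0 <= h * e by rewrite mulr_ge0 ?ltW.
  by move: hh; rewrite mulrDr; lra.
have eps0 : 0 < h ^+ 2 * B / 4 by rewrite divr_gt0 // mulr_gt0 // exprn_gt0.
have [K K0 HK] := asym _ eps0.
pose nu := 1 + 4 * h; have nu1 : 1 <= nu by rewrite /nu; lra.
pose c := b * Num.sqrt nu.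
have sn1 : 1 <= Num.sqrt nu by rewrite -[leLHS]sqrtr1 ler_sqrt //; lra.
have c0 : 0 < c by rewrite mulr_gt0 //; lra.
have cc : c ^+ 2 = nu * B by rewrite exprMn bB sqr_sqrtr 1?mulrC //; lra.
have [N HN] := sqrt_nat_large (1 + 2 * K * c + 2 * K / c + 4 * c / (h ^+ 2 * B) + 6 / (e / 2) ^+ 3).
exists N => n /HN; set s := Num.sqrt n%:R => sN.
have ss : s ^+ 2 = n%:R by rewrite sqr_sqrtr.
have p1 : 0 <= 2 * K * c by rewrite !mulr_ge0 // ltW.
have p2 : 0 <= 2 * K / c by rewrite divr_ge0 ?mulr_ge0 // ltW.
have p3 : 0 <= 4 * c / (h ^+ 2 * B).
  by apply: divr_ge0; apply: mulr_ge0; rewrite ?sqr_ge0 //; apply: ltW.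
have p4 : 0 <= 6 / (e / 2) ^+ 3 by rewrite divr_ge0 ?exprn_ge0 //; lra.
have s0 : 0 < s by lra.
pose t := c / s; have t0 : 0 < t by rewrite divr_gt0.
have ts : t * s = c by rewrite divfK // gt_eqF.
have tn : t * n%:R = c * s by rewrite -ss expr2 mulrA ts.
have tK : t * (2 * K) <= 1.
  by rewrite /t mulrAC ler_pdivrMr // mul1r mulrC; lra.
have Kn : 2 * K <= t * n%:R.
  by rewrite tn [c * s]mulrC -ler_pdivrMr //; lra.
pose a := (1 - 2 * h) * B / t ^+ 2.
have a0 : 0 <= a by rewrite divr_ge0 ?sqr_ge0 // mulr_ge0 ?(ltW B0) //; lra.
have := restricted_gf_split (hQ n) t0 (ltW h0) a0.
have th (z : R) : 1 / 2 <= z <= 2 -> 0 < t * z /\ t * z * K <= 1 /\ K <= t * z * n%:R.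
  move=> /andP[z1 z2]; split; first by rewrite mulr_gt0 //; lra.
  split; first by apply: le_trans tK; rewrite -mulrA ler_wpM2l ?(ltW t0) // ler_wpM2r ?(ltW K0).
  rewrite mulrAC; move: Kn; set w := t * n%:R => Kn; nra.
have [_ [_ _]] := th 1 ltac:(lra); rewrite ?mulr1.
have [tp0 [tpK tpn]] := th (1 + h) ltac:(lra).
have [tm0 [tmK tmn]] := th (1 - h) ltac:(lra).
have [_ [t1K t1n]] := th 1 ltac:(lra).
rewrite mulr1 in t1K t1n.
have /andP[low _] := HK t n t0 t1K t1n.
have /andP[_ up1] := HK _ n tp0 tpK tpn.
have /andP[_ up2] := HK _ n tm0 tmK tmn.
set y := t^-1; have y0 : 0 < y by rewrite invr_gt0.
have ty : t * y = 1 by rewrite divff // gt_eqF.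
have ta : t * a = (1 - 2 * h) * B * y.
  by rewrite /a /y; field; rewrite gt_eqF.
have tn' : t * n%:R = nu * B * y.
  by rewrite tn -cc /y /t; field; rewrite !gt_eqF.
(* [X] bounds each of the two tails, while the whole sum is at least [3 * X]; the middle range is
   thus left with at least [X]. *)
set X := expR ((B - 3 / 4 * h ^+ 2 * B) * y).
have X0 : 0 <= X := expR_ge0 _.
have hB0 : 0 < h ^+ 2 * B by rewrite mulr_gt0 ?exprn_gt0.
have XL : 3 * X <= restricted_gf (r_ n) n t.
  apply: le_trans low; rewrite -/y.
  have -> : (B - h ^+ 2 * B / 4) * y = h ^+ 2 * B / 2 * y + (B - 3 / 4 * h ^+ 2 * B) * y.
    by field.
  rewrite expRD ler_wpM2r // (le_trans _ (expR_ge1Dx _)) //.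
  have : 2 <= h ^+ 2 * B / 2 * y.
    rewrite /y /t invf_div mulrA ler_pdivlMr //.
    have : 4 * c / (h ^+ 2 * B) <= s by move: sN p1 p2 p4 K0; clear; lra.
    by rewrite ler_pdivrMr //; clear; lra.
  clear; lra.
have T1 : expR (h * t * a) * restricted_gf (r_ n) n (t * (1 + h)) <= X.
  apply: le_trans (ler_wpM2l (expR_ge0 _) up1) _.
  rewrite -expRD ler_expR -mulrA ta invfM -/y.
  rewrite (_ : h * _ + _ = (h * ((1 - 2 * h) * B) + (B + h ^+ 2 * B / 4) / (1 + h)) * y); last by ring.
  by apply: ler_wpM2r (ltW y0) _ _ (peak_low h0 (ltW B0)).
have T3 : expR (- (h * t * n%:R)) * restricted_gf (r_ n) n (t * (1 - h)) <= X.
  apply: le_trans (ler_wpM2l (expR_ge0 _) up2) _.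
  rewrite -expRD ler_expR -mulrA tn' invfM -/y.
  rewrite (_ : - _ + _ = (- (h * (nu * B)) + (B + h ^+ 2 * B / 4) / (1 - h)) * y); last by ring.
  by apply: ler_wpM2r (ltW y0) _ _ (peak_high hI (ltW B0)).
move=> split_le.
have nQ : X <= (n * Q n)%:R * expR (- (t * a)).
  move: split_le T1 T3 XL; clear.
  by set u := _ * restricted_gf _ _ _; set v := expR (- (h * _ * _)) * _; lra.
have nQ' : X * expR (t * a) <= n%:R * (Q n)%:R.
  have := ler_wpM2r (expR_ge0 (t * a)) nQ.
  have E : expR (- (t * a)) * expR (t * a) = 1 by rewrite mulrC expRxMexpNx_1.
  by rewrite /= -[X in _ <= X]mulrA E mulr1 natrM.
have n0 : 0 < n%:R :> R by rewrite -ss exprn_gt0.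
rewrite -(ler_pM2l n0); apply: le_trans nQ'.
have nexp : n%:R <= expR (e / 2 * s).
  by rewrite -ss; apply: sqr_le_expR; [rewrite divr_gt0|move: sN p1 p2 p3; clear; lra].
apply: le_trans (ler_wpM2r (expR_ge0 _) nexp) _.
rewrite /X -!expRD ler_expR ta.
have sw : s * b = B * y * Num.sqrt nu.
  rewrite -bB /y /t /c; field.
  by rewrite !gt_eqF // (lt_le_trans ltr01 sn1).
set w := Num.sqrt nu in sw sn1.
have ww : w <= 1 + 2 * h.
  have h12 : 0 <= 1 + 2 * h by move: h0; clear; lra.
  rewrite -[leRHS](ger0_norm h12) -sqrtr_sqr ler_sqrt ?sqr_ge0 // /nu.
  by have := sqr_ge0 h; clear; rewrite !expr2; lra.
apply: (@le_trans _ _ ((2 - 7 * h) * (s * b))).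
  have : 7 * h * b * s <= e / 2 * s by rewrite ler_wpM2r // ltW.
  clear; lra.
rewrite sw; have By0 : 0 < B * y by rewrite mulr_gt0.
have wI : 0 <= w <= 1 + 2 * h by rewrite ww sqrtr_ge0.
have := ler_wpM2l (ltW By0) (peak_value hI wI); clear; lra.
Qed.

(** * Partitions with missing subset sums *)

(* Base of the weights [penalty ^ (number of pairs)]; any small constant would do. *)
Definition penalty (R : realType) : R := 1 / 200.

(** It suffices that [200 <= 2 ^ 8 <= exp 8]. The resulting cost [exp(8 * M)] forces [M] to be a
    small multiple of [n^(1/2)]. *)
Lemma penalty_ge (R : realType) (M : nat) : expR (- (8 * M%:R)) <= penalty R ^+ M.
Proof.
rewrite -mulNr expRM_natr lerXn2r ?nnegrE ?expR_ge0 //; first by rewrite /penalty; lra.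
have e2 : 2 <= expR 1 :> R by have := @expR_ge1Dx R 1; lra.
have e8 : expR 8 = expR 1 ^+ 8 :> R by rewrite -expRM_natr mul1r.
have : 2 ^+ 8 <= expR 1 ^+ 8 :> R by rewrite lerXn2r ?nnegrE ?expR_ge0.
rewrite -e8 => H; rewrite expRN /penalty div1r lef_pV2 ?posrE ?expR_gt0 //.
by apply: le_trans H; rewrite -natrX ler_nat.
Qed.

(** The second product in [few_pairs] at [l = penalty R]: the saving over the full generating
    function. *)
Definition pair_prod (R : realType) (r k : nat) (t : R) : R :=
  \prod_(1 <= j < k | (j.*2 < k)%N)
     (1 - (1 - penalty R) * (1 - (part_weight r (expR (- t) ^+ j))^-1)
                      * (1 - (part_weight r (expR (- t) ^+ (k - j)))^-1)).

(** The corresponding saving in [few_small_parts]: [1 + l * (g - 1)] divided by [g] is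
    [l + (1 - l) / g]. *)
Definition small_prod (R : realType) (r w : nat) (t : R) : R :=
  \prod_(1 <= j < w.+1) (penalty R + (1 - penalty R) / part_weight r (expR (- t) ^+ j)).

Section Cards.
Variables (R : realType) (r n M : nat) (t G S : R).
Hypotheses (t0 : 0 < t) (hG : restricted_gf r n.+1 t <= expR (G / t)).

Let x : R := expR (- t).
Let x0 : 0 < x. Proof. exact: expR_gt0. Qed.
Let l0 : 0 < penalty R. Proof. by rewrite /penalty; lra. Qed.
Let l1 : penalty R <= 1. Proof. by rewrite /penalty; lra. Qed.

Let unweight (c P : R) : 0 <= c -> x ^+ n * penalty R ^+ M * c <= P ->
  c <= expR (t * n%:R + 8 * M%:R) * P.
Proof.
move=> c0 /(ler_wpM2l (expR_ge0 (t * n%:R + 8 * M%:R))); apply: le_trans.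
rewrite mulrA ler_peMl // expRD.
have -> : x ^+ n = expR (- (t * n%:R)) by rewrite /x -expRM_natr mulNr.
rewrite mulrACA expRxMexpNx_1 mul1r.
have := ler_wpM2l (expR_ge0 (8 * M%:R)) (penalty_ge R M).
by rewrite expRxMexpNx_1.
Qed.

Lemma card_few_pairs (k : nat) : (0 < k <= n.+1)%N ->
  pair_prod r k t <= expR S ->
  #|[set s in restricted r n | (pair_count (parts s) k <= M)%N]|%:R <=
    expR (t * n%:R + 8 * M%:R + G / t + S).
Proof.
move=> kn hS; have := few_pairs r x0 l0 l1 M kn => /unweight -/(_ (ler0n _ _)) H.
apply: (le_trans H); rewrite -[_ + G / t + S]addrA [leRHS]expRD ler_wpM2l ?expR_ge0 // expRD.
apply: ler_pM => //; first exact/ltW/restricted_gf_gt0.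
apply: prodr_ge0 => j _.
have gI i : 0 <= 1 - (part_weight r (x ^+ i))^-1 <= 1.
  have g1 : 1 <= part_weight r (x ^+ i).
    rewrite /part_weight big_ord_recl expr0 lerDl; apply: sumr_ge0 => m _.
    by rewrite !exprn_ge0 // ltW.
  rewrite subr_ge0 invf_le1 ?g1 ?gerBl ?invr_ge0 ?(lt_le_trans _ g1) //.
  exact: (le_trans _ g1).
have /andP[a0 a1] := gI j; have /andP[b0 b1] := gI (k - j)%N.
have l2 : 0 <= 1 - penalty R <= 1 by rewrite /penalty; lra.
have /andP[c0 c1] := l2.
rewrite subr_ge0 mulr_ile1 ?mulr_ge0 ?mulr_ile1 //.
Qed.

Lemma card_few_small (w : nat) : (w <= n.+1)%N ->
  small_prod r w t <= expR S ->
  #|[set s in restricted r n | (count (mem (parts s)) (iota 1 w) < M)%N]|%:R <=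
    expR (t * n%:R + 8 * M%:R + G / t + S).
Proof.
move=> wn hS; have := few_small_parts r x0 l0 l1 M wn => /unweight -/(_ (ler0n _ _)) H.
apply: (le_trans H); rewrite -[_ + G / t + S]addrA [leRHS]expRD ler_wpM2l ?expR_ge0 // expRD.
have gpos i : 0 < part_weight r (x ^+ i).
  rewrite /part_weight big_ord_recl expr0 ltr_pwDl //; apply: sumr_ge0 => m _.
  by rewrite !exprn_ge0 // ltW.
apply: (@le_trans _ _ (restricted_gf r n.+1 t * small_prod r w t)); last first.
  apply: ler_pM => //; first exact/ltW/restricted_gf_gt0.
  apply: prodr_ge0 => j _; rewrite addr_ge0 ?ltW // mulr_gt0 ?invr_gt0 //; exact: gpos || by rewrite /penalty; lra.
rewrite le_eqVlt; apply/orP; left; apply/eqP.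
rewrite /restricted_gf /small_prod [in LHS](@big_cat_nat _ _ _ w.+1) //= [in RHS](@big_cat_nat _ _ _ w.+1 1 n.+2) //=.
rewrite mulrAC -big_split /=; congr (_ * _).
  apply: eq_big_nat => j /andP[_ jw]; rewrite -ltnS jw -/x.
  by field; rewrite gt_eqF.
by apply: eq_big_nat => j /andP[jw _]; rewrite leqNgt jw.
Qed.

(** Most of the tilt, [y = exp(-(1 - h) t)], goes into the saving [y ^+ H]. The rest,
    [z = exp(- h t)], keeps the factor of each part above [D] below [1 + r * z ^+ D], and the
    product of these factors below [exp(r * S)]. *)
Lemma card_many_large (D H : nat) (h : R) : 0 < h -> h < 1 ->
  n.+1%:R * expR (- (h * t * D%:R)) <= S ->
  #|[set s in restricted r n | (H < sumn [seq i <- parts s | (D < i)%N])%N]|%:R <=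
    expR (t * n%:R + G / t - (1 - h) * t * H%:R + r%:R * S).
Proof.
move=> h0 h1 hS; set c := #|_|%:R.
pose y := expR (- ((1 - h) * t)); pose z := expR (- (h * t)).
have xE : x = y * z by rewrite /x /y /z -expRD; congr expR; ring.
have y1 : y <= 1 by rewrite expR_le1 oppr_le0 mulr_ge0 // ?ltW // subr_gt0.
have z1 : z <= 1 by rewrite expR_le1 oppr_le0 mulr_ge0 // ltW.
have := many_large_parts r n x0 D H (expR_gt0 _) y1 (expR_gt0 _) xE.
move=> /(ler_wpM2l (expR_ge0 (t * n%:R))).
rewrite {1}/x -expRM_natr mulNr mulrA expRxMexpNx_1 mul1r => H1.
apply: (le_trans H1).
rewrite -!addrA expRD ler_wpM2l ?expR_ge0 // addrCA expRD.
rewrite /y -expRM_natr mulNr ler_wpM2l ?expR_ge0 // expRD.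
have gpos i : 0 < part_weight r (x ^+ i).
  rewrite /part_weight big_ord_recl expr0 ltr_pwDl //; apply: sumr_ge0 => m _.
  by rewrite !exprn_ge0 // ltW.
have zD : z ^+ D = expR (- (h * t * D%:R)) by rewrite /z -expRM_natr mulNr.
have gz j : (D < j)%N -> part_weight r (z ^+ j) <= expR (r%:R * expR (- (h * t * D%:R))).
  move=> Dj; apply: le_trans (expR_ge1Dx _).
  rewrite /part_weight big_ord_recl expr0 lerD2l -zD mulr_natl.
  have -> : z ^+ D *+ r = \sum_(i < r) z ^+ D by rewrite sumr_const card_ord.
  apply: ler_sum => i _; rewrite /= -exprM.
  have Dji : (D <= j * bump 0 i)%N.
    by rewrite /bump leq0n add1n (leq_trans (ltnW Dj)) // leq_pmulr.
  by apply: ler_wiXn2l; [exact: expR_ge0|exact: z1|exact: Dji].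
apply: (@le_trans _ _ (restricted_gf r n.+1 t * \prod_(1 <= j < n.+2) expR (r%:R * expR (- (h * t * D%:R))))).
  rewrite /restricted_gf -big_split /= !big_nat; apply: ler_prod => j _; rewrite -/x.
  have E1 : 1 <= expR (r%:R * expR (- (h * t * D%:R))).
    by apply: le_trans (expR_ge1Dx _); rewrite lerDl mulr_ge0 ?expR_ge0.
  case: leqP => jD; first by rewrite ltW //= ler_peMr // ltW.
  apply/andP; split.
    by rewrite /part_weight; apply: sumr_ge0 => m _; rewrite !exprn_ge0 ?expR_ge0.
  apply: (le_trans (gz _ jD)); rewrite ler_peMl ?expR_ge0 //.
  rewrite /part_weight big_ord_recl expr0 lerDl; apply: sumr_ge0 => m _.
  by rewrite !exprn_ge0 // ltW.
apply: ler_pM => //; [exact/ltW/restricted_gf_gt0|by apply: prodr_ge0 => j _; exact: expR_ge0|].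
rewrite prodr_const_nat subn1 /= -expRM_natr ler_expR -mulrA ler_wpM2l //.
by rewrite mulrC.
Qed.

End Cards.

(** * Union bound over the exceptional partitions *)

Lemma card_or_le (T : finType) (A : {set T}) (P Q : pred T) :
  (#|[set s in A | P s || Q s]| <= #|[set s in A | P s]| + #|[set s in A | Q s]|)%N.
Proof.
apply: leq_trans (leq_card_setU _ _); apply/subset_leq_card/fintype.subsetP => s.
by rewrite !inE => /andP[-> /orP[->|->]]; rewrite ?orbT.
Qed.

Lemma card_has_le (T : finType) (I : eqType) (A : {set T}) (P : I -> pred T) (ks : seq I) :
  (#|[set s in A | has (fun k => P k s) ks]| <= \sum_(k <- ks) #|[set s in A | P k s]|)%N.
Proof.
elim: ks => [|k ks IHks].
  by rewrite big_nil leqn0 cards_eq0; apply/eqP/setP => s; rewrite !inE /= andbF.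
by rewrite big_cons; apply: leq_trans (card_or_le _ _ _) _; rewrite leq_add2l.
Qed.

Lemma truncnP (R : realType) (z : R) : 0 <= z ->
  (Num.truncn z)%:R <= z < (Num.truncn z)%:R + 1.
Proof. by move=> z0; have := truncn_itv z0; rewrite natr1. Qed.

Lemma num_sets_union (r n y1 y2 M H : nat) : (y1 <= y2)%N ->
  ((\sum_(y1 <= k < y2.+1) k + H).*2 <= n)%N ->
  (num_sets r n <= 2 ^ y1 +
    (\sum_(k <- index_iota y1 y2.+1)
       #|[set q in restricted r n | (pair_count (parts q) k <= M)%N]| +
     (#|[set q in restricted r n | (count (mem (parts q)) (iota 1 (y2 - y1)) < M)%N]| +
      #|[set q in restricted r n |
          (H < sumn [seq x <- parts q | ('C(M.+1, 2) < x)%N])%N]|)))%N.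
Proof.
move=> y12 tot.
pose bad (q : seq nat) := has (fun k => (pair_count q k <= M)%N) (index_iota y1 y2.+1) ||
  ((count (mem q) (iota 1 (y2 - y1)) < M)%N ||
   (H < sumn [seq x <- q | ('C(M.+1, 2) < x)%N])%N).
apply: leq_trans (@num_sets_bound r n y1 bad _) _.
  move=> q qP; rewrite /bad !negb_or -all_predC => /and3P[/allP b1 b2 b3] a.
  have qn : sumn (parts q) = n by move: qP; rewrite 2!inE => /andP[/and3P[_ _ /eqP]].
  rewrite -{1}qn; apply: (@subsum_middle _ y1 y2 (y2 - y1) M H) => //.
  - by move=> k kI; have := b1 k; rewrite mem_index_iota ltnS kI /= -ltnNge; exact.
  - by rewrite leqNgt.
  - by rewrite leqNgt.
  - by rewrite qn.
rewrite leq_add2l /bad.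
apply: leq_trans (card_or_le _ _ _) _; apply: leq_add; first exact: card_has_le.
exact: card_or_le.
Qed.

Lemma window_exists (R : realType) (t L : R) : 0 < t <= 1 / 100 -> 1 <= L ->
  exists y1 y2 : nat, [/\ (0 < y1 <= y2)%N, L - 7 / 100 <= t * y1%:R <= L - 7 / 100 + t,
    t * y2%:R <= L + 7 / 100 & 14 / 100 - 2 * t <= t * (y2 - y1)%:R].
Proof.
move=> /andP[t0 t1] L1.
have u10 : 0 <= (L - 7 / 100) / t by rewrite divr_ge0 ?ltW //; lra.
have u20 : 0 <= (L + 7 / 100) / t by rewrite divr_ge0 ?ltW //; lra.
have /andP[] := truncnP u10; have /andP[] := truncnP u20.
rewrite ler_pdivlMr // ltr_pdivrMr // ler_pdivlMr // ltr_pdivrMr //.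
set b := Num.truncn _; set a := Num.truncn _ => b1 b2 a1 a2.
have aE : a.+1%:R = a%:R + 1 :> R by rewrite natr1.
have ab : (a.+1 <= b)%N.
  rewrite -(ler_nat R) aE -(ler_pM2r t0); lra.
exists a.+1, b; split=> //.
- rewrite aE; apply/andP; split; lra.
- lra.
by rewrite natrB // aE; lra.
Qed.

(** The window has at most [(15 / 100) / t] integers, none above [(1275 / 1000) / t], so after
    multiplication by [t ^+ 2] it contributes less than 0.192. Adding 14 percent of
    [t ^+ 2 * n >= 0.68] still leaves less than half of it. *)
Lemma window_sum (R : realType) (t L : R) (y1 y2 n H : nat) : 0 < t <= 1 / 100 ->
  1 <= L <= 241 / 200 -> (y1 <= y2)%N -> L - 7 / 100 <= t * y1%:R ->
  t * y2%:R <= L + 7 / 100 -> 68 / 100 <= t ^+ 2 * n%:R -> H%:R <= 14 / 100 * n%:R :> R ->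
  ((\sum_(y1 <= k < y2.+1) k + H).*2 <= n)%N.
Proof.
move=> /andP[t0 t1] /andP[L1 L2] y12 Y1 Y2 n1 H1.
have sumk : (\sum_(y1 <= k < y2.+1) k <= (y2 - y1).+1 * y2)%N.
  have -> : ((y2 - y1).+1 * y2 = \sum_(y1 <= k < y2.+1) y2)%N.
    by rewrite sum_nat_const_nat subSn // mulnC.
  by rewrite !big_nat; apply: leq_sum => k /andP[_]; rewrite ltnS.
apply: (@leq_trans ((y2 - y1).+1 * y2 + H).*2); first by rewrite leq_double leq_add2r.
have tt0 : 0 < t ^+ 2 by rewrite exprn_gt0.
rewrite -muln2 -(ler_nat R) natrM natrD natrM -natr1 natrB //.
rewrite -(ler_pM2l tt0).
have : (t * (y2%:R - y1%:R + 1)) * (t * y2%:R) <= (15 / 100) * (1275 / 1000).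
  apply: ler_pM; [|by rewrite mulr_ge0 // ltW|lra|lra].
  by rewrite mulr_ge0 ?(ltW t0) // -natrB // natr1.
have := ler_wpM2l (ltW tt0) H1.
rewrite /= expr2 in n1 *; lra.
Qed.

(** ['C(M.+1, 2)] is at least [(eps * s)^2 / 4], of order [n]; multiplied by [t] it has order
    [s = n^(1/2)], and the exponential outweighs [n]. *)
Lemma large_tail (R : realType) (n M : nat) (t tau eps s : R) :
  0 < tau -> 0 < eps -> 1 <= s -> s ^+ 2 = n%:R -> t * s = tau -> 0 < t ->
  2 <= eps * s -> eps * s < M%:R + 1 ->
  6 / (tau * eps ^+ 2 / 400) ^+ 3 <= s ->
  n.+1%:R * expR (- (1 / 100 * t * 'C(M.+1, 2)%:R)) <= 2.
Proof.
move=> tau0 eps0 s1 ss ts t0 es2 M2 hs.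
set ze := tau * eps ^+ 2 / 400 in hs.
have ze0 : 0 < ze by rewrite divr_gt0 ?mulr_gt0 ?exprn_gt0 ?ltr0n.
have DR : 'C(M.+1, 2)%:R * 2 = (M%:R + 1) * M%:R :> R.
  have := bin_ffact M.+1 2; rewrite !ffactnS ffactn0 muln1 => DE.
  by rewrite natr1 -!natrM DE.
have D4 : (eps * s) ^+ 2 <= 4 * 'C(M.+1, 2)%:R.
  have -> : 4 * 'C(M.+1, 2)%:R = (M%:R + 1) * (2 * M%:R) :> R by rewrite mulrCA -DR; ring.
  rewrite expr2; apply: ler_pM; lra.
have zeD : ze * s <= 1 / 100 * t * 'C(M.+1, 2)%:R.
  have -> : ze * s = 1 / 400 * t * (eps * s) ^+ 2 by rewrite /ze -ts; field.
  have -> : 1 / 100 * t * 'C(M.+1, 2)%:R = 1 / 400 * t * (4 * 'C(M.+1, 2)%:R) by field.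
  by apply: ler_wpM2l D4; move: t0; clear; lra.
rewrite expRN ler_pdivrMr ?expR_gt0 //.
have h1 : s ^+ 2 <= expR (ze * s) by exact: sqr_le_expR.
have h2 : expR (ze * s) <= expR (1 / 100 * t * 'C(M.+1, 2)%:R) by rewrite ler_expR.
have h3 : 1 <= s ^+ 2 by rewrite exprn_ege1.
rewrite -natr1 -ss; lra.
Qed.

(** As [B - S = tau ^+ 2 - del], the exponent [t * n + (B - S) / t] is [(2 * tau - 8 * nu) * s]. One
    [nu] pays for the error [del / 8] in the generating function, one for the cost [8 * M];
    roundings go into [4 + 2 * r%:R], and the number of exceptional events into [s ^+ 2 * 2]. *)
Lemma num_sets_upper_at (R : realType) (r n M : nat) (t tau del B L s : R) :
  let nu := del / (8 * tau) in let S := B - tau ^+ 2 + del in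
  let W := expR ((2 * tau - 6 * nu) * s + (4 + 2 * r%:R)) in
  0 < t <= 1 / 100 -> 4 / 5 <= tau -> 0 < del -> 2 <= s -> t * s = tau -> s ^+ 2 = n%:R ->
  restricted_gf r n.+1 t <= expR ((B + del / 8) / t) ->
  M%:R <= del / (64 * tau) * s ->
  n.+1%:R * expR (- (1 / 100 * t * 'C(M.+1, 2)%:R)) <= 2 ->
  (forall k, (0 < k)%N -> L - 7 / 100 <= t * k%:R <= L + 7 / 100 ->
     pair_prod r k t <= expR (1 - S / t)) ->
  (forall w, 14 / 100 - 2 * t <= t * w%:R <= 14 / 100 ->
     small_prod r w t <= expR (2 - S / t)) ->
  S <= 99 / 100 * (14 / 100) * tau ^+ 2 ->
  1 <= L <= 241 / 200 -> 68 / 100 <= tau ^+ 2 -> L + del <= 2 * tau ^+ 2 ->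
  (num_sets r n)%:R <= s ^+ 2 * 2 * W.
Proof.
move=> nu S W /andP[t0 t1] tau45 del0 s2 ts ss hG hM hD hpair hsmall hlarge hL tau2 hLd.
have s0 : 0 < s by apply: lt_le_trans s2.
have tau0 : 0 < tau by apply: lt_le_trans tau45; rewrite divr_gt0.
have /andP[L1 L2] := hL.
have tn : t * n%:R = tau * s by rewrite -ss expr2 mulrA ts.
have invt (z : R) : z / t = z / tau * s.
  by rewrite -ts; field; rewrite !gt_eqF.
have tI : 0 < t <= 1 / 100 by rewrite t0.
have [y1 [y2 [/andP[y10 y12] /andP[Y1 Y1'] Y2 Y12]]] := window_exists tI L1.
(* The huge parts are granted 14 percent of [n]; exceeding that saves
   [99 / 100 * (14 / 100) * tau ^+ 2 / t] up to rounding, at least [S / t]. *)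
have n0 : 0 <= 14 / 100 * n%:R :> R by rewrite mulr_ge0 // divr_ge0.
have /andP[H1 H2] := truncnP n0; set H := Num.truncn _ in H1 H2.
have ttn : t ^+ 2 * n%:R = tau ^+ 2 by rewrite -ss -exprMn ts.
have tot := @window_sum R t L y1 y2 n H tI hL y12 Y1 Y2 (eq_ind _ (fun z => 68 / 100 <= z) tau2 _ (esym ttn)) H1.
have nu0 : 0 < nu by rewrite divr_gt0 // mulr_gt0.
have nus : 0 < nu * s by rewrite mulr_gt0.
have nuE : nu * tau = del / 8 by rewrite /nu; field; rewrite gt_eqF.
have SE : t * n%:R + (B + del / 8) / t - S / t = (2 * tau - 7 * nu) * s.
  by rewrite tn !invt /S /nu; field; rewrite gt_eqF.
have M8 : 8 * M%:R <= nu * s.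
  have -> : nu * s = 8 * (del / (64 * tau) * s) by rewrite /nu; field; rewrite gt_eqF.
  by rewrite ler_pM2l.
have r0 : 0 <= r%:R :> R by [].
have y2s : y2%:R <= 2 * s.
  rewrite -(ler_pM2l t0) (le_trans Y2) // mulrCA ts; clear -L2 tau45; lra.
have y2n : (y2 <= n)%N.
  rewrite -(ler_nat R) -ss (le_trans y2s) // expr2 ler_wpM2r // ltW //.
have bad1 k : k \in index_iota y1 y2.+1 ->
    #|[set q in restricted r n | (pair_count (parts q) k <= M)%N]|%:R <= W.
  rewrite mem_index_iota ltnS => /andP[k1 k2].
  have kn : (0 < k <= n.+1)%N by rewrite (leq_trans y10 k1) (leq_trans k2) // ltnW.
  have tk : L - 7 / 100 <= t * k%:R <= L + 7 / 100.
    by rewrite (le_trans Y1) ?(le_trans _ Y2) // ler_pM2l // ler_nat.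
  apply: le_trans (card_few_pairs M hG kn (hpair k (leq_trans y10 k1) tk)) _.
  rewrite ler_expR; move: SE M8 r0 nus; clear; set g := _ / t; set h := _ / t; lra.
have bad2 : #|[set q in restricted r n | (count (mem (parts q)) (iota 1 (y2 - y1)) < M)%N]|%:R <= W.
  have wn : (y2 - y1 <= n.+1)%N by apply: leq_trans (leq_subr _ _) (leqW y2n).
  have tw : 14 / 100 - 2 * t <= t * (y2 - y1)%:R <= 14 / 100.
    rewrite Y12 /= natrB // mulrBr; move: Y1 Y2; clear; lra.
  apply: le_trans (card_few_small M hG wn (hsmall (y2 - y1)%N tw)) _.
  rewrite ler_expR; move: SE M8 r0 nus; clear; set g := _ / t; set h := _ / t; lra.
have bad3 : #|[set q in restricted r n | (H < sumn [seq x <- parts q | ('C(M.+1, 2) < x)%N])%N]|%:R <= W.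
  have h1 : (1 / 100 : R) < 1 by rewrite ltr_pdivrMr // mul1r ltr1n.
  have h0 : 0 < (1 / 100 : R) by rewrite divr_gt0.
  apply: le_trans (card_many_large t0 hG H h0 h1 hD) _.
  rewrite ler_expR.
  have St : S / t <= 99 / 100 * (14 / 100) * (tau * s).
    rewrite ler_pdivrMr //.
    have -> : 99 / 100 * (14 / 100) * (tau * s) * t = 99 / 100 * (14 / 100) * (tau * (t * s)).
      by ring.
    by rewrite ts -expr2.
  have tH : 14 / 100 * (tau * s) - t <= t * H%:R.
    rewrite -tn (_ : _ - _ = t * (14 / 100 * n%:R - 1)); last by ring.
    by rewrite ler_wpM2l ?(ltW t0) // lerBlDr ltW.
  have -> : (1 - 1 / 100) * t * H%:R = 99 / 100 * (t * H%:R) by field.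
  move: SE M8 r0 nus St tH t1 t0; clear; set g := _ / t; set h := _ / t; set th := t * H%:R; lra.
(* The crude [2 <= e] suffices: [t * y1] is at most [L - 7 / 100 + t], and
   [L + del <= 2 * tau ^+ 2]. *)
have pow2 : (2 ^ y1)%:R <= W.
  have e2 : 2 <= expR 1 :> R by have := @expR_ge1Dx R 1; clear; lra.
  rewrite natrX; apply: (@le_trans _ _ (expR y1%:R)).
    by rewrite -[X in expR X]mul1r expRM_natr lerXn2r ?nnegrE ?expR_ge0.
  rewrite ler_expR.
  have u1 : y1%:R - 1 <= (2 * tau - 8 * nu) * s.
    rewrite -(ler_pM2l t0).
    have -> : t * ((2 * tau - 8 * nu) * s) = (2 * tau - 8 * nu) * (t * s) by ring.
    rewrite ts; move: Y1' hLd nuE; clear; rewrite expr2; lra.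
  move: u1 nus r0; clear; lra.
have Wsum : (num_sets r n)%:R <= ((y2 - y1)%:R + 4) * W.
  have := num_sets_union r M y12 tot; rewrite -(ler_nat R) => /le_trans; apply.
  rewrite !natrD natr_sum.
  have : \sum_(k <- index_iota y1 y2.+1)
      #|[set q in restricted r n | (pair_count (parts q) k <= M)%N]|%:R <= ((y2 - y1)%:R + 1) * W.
    have -> : ((y2 - y1)%:R + 1) * W = \sum_(k <- index_iota y1 y2.+1) W.
      by rewrite sumr_const_nat subSn // natr1 mulr_natl.
    by rewrite big_seq [leRHS]big_seq; apply: ler_sum => k; exact: bad1.
  move: bad2 bad3 pow2; clear; set a := (2 ^ y1)%:R; set b := \sum_(_ <- _) _.
  set c := _%:R; set d := _%:R; lra.
apply: (le_trans Wsum); rewrite ler_wpM2r ?expR_ge0 //.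
have : (y2 - y1)%:R <= 2 * s by apply: le_trans y2s; rewrite ler_nat leq_subr.
move: s2; clear; rewrite expr2; nra.
Qed.

Lemma num_sets_upper (R : realType) (r : nat) (B tau del L : R) :
  4 / 5 <= tau -> 0 < del -> restricted_gf_asymp B (fun=> r) ->
  (forall t k, 0 < t -> (0 < k)%N -> L - 7 / 100 <= t * k%:R <= L + 7 / 100 ->
     pair_prod r k t <= expR (1 - (B - tau ^+ 2 + del) / t)) ->
  (forall t w, 0 < t -> 14 / 100 - 2 * t <= t * w%:R <= 14 / 100 ->
     small_prod r w t <= expR (2 - (B - tau ^+ 2 + del) / t)) ->
  B - tau ^+ 2 + del <= 99 / 100 * (14 / 100) * tau ^+ 2 ->
  1 <= L <= 241 / 200 -> 68 / 100 <= tau ^+ 2 -> L + del <= 2 * tau ^+ 2 ->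
  exists N : nat, forall n : nat, (N <= n)%N ->
    (num_sets r n)%:R <= expR ((2 * tau - del / (2 * tau)) * Num.sqrt n%:R).
Proof.
move=> tau45 del0 asym hpair hsmall hlarge hL tau2 hLd.
have tau0 : 0 < tau by apply: lt_le_trans tau45; rewrite divr_gt0.
have e0 : 0 < del / 8 by rewrite divr_gt0.
have [K K0 HK] := asym _ e0.
(* [M] will be the integer part of [eps * s], and [8 * eps = nu] bounds the cost [8 * M] by
   [nu * s]. *)
pose eps := del / (64 * tau).
have eps0 : 0 < eps by rewrite divr_gt0 // mulr_gt0.
pose ze := tau * eps ^+ 2 / 400.
have ze0 : 0 < ze.
  apply: divr_gt0; last by rewrite ltr0n.
  by apply: mulr_gt0 => //; exact: exprn_gt0.
pose nu := del / (8 * tau).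
have nu0 : 0 < nu by rewrite divr_gt0 // mulr_gt0.
have p0 : 0 < 100 * tau by rewrite mulr_gt0.
have p1 : 0 < tau * K by rewrite mulr_gt0.
have p2 : 0 < K / tau by rewrite divr_gt0.
have p3 : 0 < 2 / eps by rewrite divr_gt0.
have p4 : 0 < 6 / ze ^+ 3 by rewrite divr_gt0 // exprn_gt0.
have p5 : 0 < 6 / nu ^+ 3 by rewrite divr_gt0 // exprn_gt0.
have p6 : 0 < (5 + 2 * r%:R) / nu by rewrite divr_gt0 // ltr_pwDl // mulr_ge0.
have [N HN] := sqrt_nat_large (10 + 100 * tau + tau * K + K / tau + 2 / eps
   + 6 / ze ^+ 3 + 6 / nu ^+ 3 + (5 + 2 * r%:R) / nu).
exists N => n /HN; set s := Num.sqrt n%:R => sN.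
have ss : s ^+ 2 = n%:R by rewrite sqr_sqrtr.
have [s10 sp0 sp1 sp2 [sp3 sp4 sp5 sp6]] :
    [/\ 10 <= s, 100 * tau <= s, tau * K <= s, K / tau <= s &
     [/\ 2 / eps <= s, 6 / ze ^+ 3 <= s, 6 / nu ^+ 3 <= s & (5 + 2 * r%:R) / nu <= s]].
  move: sN p0 p1 p2 p3 p4 p5 p6; clear; set a := 100 * tau; set b := tau * K; set c := K / tau.
  set d := 2 / eps; set f := 6 / ze ^+ 3; set g := 6 / nu ^+ 3; set h := _ / nu.
  by split; [lra|lra|lra|lra|split; lra].
have s0 : 0 < s by apply: lt_le_trans s10.
pose t := tau / s; have t0 : 0 < t by rewrite divr_gt0.
have ts : t * s = tau by rewrite divfK // gt_eqF.
have tI : 0 < t <= 1 / 100 by rewrite t0 ler_pdivrMr //; move: sp0; clear; lra.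
have tK : t * K <= 1 by rewrite mulrAC ler_pdivrMr // mul1r.
have Kn : K <= t * n.+1%:R.
  rewrite -natr1 -ss mulrDr mulr1 expr2 mulrA ts.
  apply: le_trans (_ : tau * s <= _); last by rewrite lerDl ltW.
  by rewrite mulrC -ler_pdivrMr.
have /andP[_ hG] := HK t n.+1 t0 tK Kn.
pose M := Num.truncn (eps * s).
have es0 : 0 <= eps * s by rewrite mulr_ge0 // ltW.
have /andP[M1 M2] := truncnP es0; rewrite -/M in M1 M2.
have es2 : 2 <= eps * s by rewrite mulrC -ler_pdivrMr.
have s1 : 1 <= s by apply: le_trans s10; rewrite ler1n.
have hD := large_tail tau0 eps0 s1 ss ts t0 es2 M2 sp4.
have s2 : 2 <= s by apply: le_trans s10; rewrite ler_nat.
apply: le_trans (num_sets_upper_at tI tau45 del0 s2 ts ss hG M1 hD (hpair t ^~ t0) (hsmall t ^~ t0)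
   hlarge hL tau2 hLd) _.
(* Of the margin [6 * nu], one [nu] absorbs [s ^+ 2] and one the constants; [4 * nu] remains. *)
have -> : del / (2 * tau) = 4 * nu by rewrite /nu; field; rewrite gt_eqF.
rewrite -/nu -mulrA; apply: (@le_trans _ _ (expR (nu * s) * (expR 1 * expR ((2 * tau - 6 * nu) * s + (4 + 2 * r%:R))))).
  apply: ler_pM; rewrite ?sqr_ge0 ?mulr_ge0 ?expR_ge0 //; first exact: sqr_le_expR.
  by rewrite ler_wpM2r ?expR_ge0 //; have := @expR_ge1Dx R 1; clear; lra.
rewrite -!expRD ler_expR.
move: sp6; rewrite ler_pdivrMr //; clear; lra.
Qed.

(** * Numerical estimates *)

Lemma sum_pairs_le (R : realFieldType) (k : nat) (a : nat -> R) :
  (forall j, 0 <= a j) ->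
  \sum_(1 <= j < k | (j.*2 < k)%N) (a j + a (k - j)%N) <= \sum_(1 <= j < k) a j.
Proof.
move=> a0; rewrite big_split /= [leRHS](bigID (fun j => (j.*2 < k)%N)) /= lerD2l.
have -> : \sum_(1 <= j < k | (j.*2 < k)%N) a (k - j)%N = \sum_(1 <= j < k | (k < j.*2)%N) a j.
  rewrite [RHS]big_nat_rev /= big_nat_cond [RHS]big_nat_cond.
  apply: eq_big => [j|j /andP[jI _]]; first by apply/idP/idP; lia.
  by congr a; lia.
rewrite [leRHS](bigID (fun j => (k < j.*2)%N)) /=.
rewrite (_ : \sum_(1 <= j < k | _ && _) a j = \sum_(1 <= j < k | (k < j.*2)%N) a j).
  by rewrite lerDl; apply: sumr_ge0.
by apply: eq_bigl => j; case: ltngtP => //; lia.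
Qed.

Lemma pair_number_ge (R : realFieldType) (k : nat) :
  k%:R / 2 - 1 <= \sum_(1 <= j < k | (j.*2 < k)%N) (1 : R).
Proof.
apply: (@le_trans _ _ (\sum_(1 <= j < k.+1./2) (1 : R))).
  rewrite sumr_const_nat lerBlDr ler_pdivrMr // -[X in _ + X]mulr1n -mulrnDr.
  by rewrite -natrM ler_nat; lia.
have [->|k0] := posnP k; first by rewrite !big_geq.
have h1 : (1 <= k.+1./2)%N by lia.
have h2 : (k.+1./2 <= k)%N by lia.
rewrite [leRHS](big_cat_nat h1 h2) /= [X in _ <= X + _]big_nat_cond.
rewrite [X in _ <= X + _](eq_bigl (fun j => (1 <= j < k.+1./2)%N)); last by move=> j; lia.
by rewrite -big_nat lerDl sumr_ge0.
Qed.

(* [c], [be], [ga] come from the tangent plane of the factor, as a function of [a + b]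
   and [a * b], at [(116 / 100, 3 / 10)]. *)
Lemma pair_prod_le (R : realType) (r : nat) (c l be ga s0 Sp L : R) :
  0 <= be -> c <= expR (- l) -> expR (- L) = 3 / 10 ->
  (forall a b : R, 0 <= a <= 1 -> 0 <= b <= 1 -> 27 / 100 <= a * b <= 33 / 100 ->
     1 - (1 - penalty R) * (1 - (part_weight r a)^-1) * (1 - (part_weight r b)^-1) <=
       c * (1 + be * (a + b - s0) - ga * (a * b - 3 / 10))) -> 0 <= c ->
  (forall u g, L - 7 / 100 <= u <= L + 7 / 100 -> 27 / 100 <= g <= 33 / 100 ->
     3 / 10 * (1 - (u - L)) <= g ->
     let ka := l + be * s0 + ga * (g - 3 / 10) in
     0 <= ka <= 1 /\ Sp <= ka * (u / 2) - be * (1 - g)) ->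
  forall (t : R) (k : nat), 0 < t -> (0 < k)%N ->
    L - 7 / 100 <= t * k%:R <= L + 7 / 100 -> pair_prod r k t <= expR (1 - Sp / t).
Proof.
move=> be0 hc hL hfac c0 hnum t k t0 k0 tk.
set u := t * k%:R in tk; set g := expR (- u).
have /andP[u1 u2] := tk.
have gE : g = 3 / 10 * expR (- (u - L)) by rewrite -hL -expRD; congr expR; ring.
have g1 : 3 / 10 * (1 - (u - L)) <= g.
  by rewrite gE ler_wpM2l ?divr_ge0 //; exact: expR_ge1Dx.
have g2 : g <= 33 / 100.
  rewrite gE; have : expR (- (u - L)) * (1 - 7 / 100) <= 1.
    rewrite expRN mulrC ler_pdivrMr ?expR_gt0 // mul1r.
    by have := expR_ge1Dx (u - L); lra.
  by have := expR_ge0 (- (u - L)); lra.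
have g27 : 27 / 100 <= g by lra.
have gI : 27 / 100 <= g <= 33 / 100 by rewrite g27.
have [/andP[ka0 ka1] hS] := hnum u g tk gI g1.
set ka := l + _ + _ in ka0 ka1 hS.
set x := expR (- t).
have x0 : 0 <= x by exact: expR_ge0.
have x1 : x <= 1 by rewrite expR_le1 oppr_le0 ltW.
have xk : x ^+ k = g by rewrite /x -expRM_natr mulNr.
(* In every pair [x ^+ j * x ^+ (k - j)] equals [g], so the tangent plane is affine in
   [x ^+ j + x ^+ (k - j)] alone, and [1 + v <= exp v] turns it into an exponential. *)
apply: (@le_trans _ _ (\prod_(1 <= j < k | (j.*2 < k)%N)
    expR (- ka + be * (x ^+ j + x ^+ (k - j))))).
  rewrite /pair_prod big_nat_cond [leRHS]big_nat_cond; apply: ler_prod => j /andP[/andP[j1 jk] _].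
  rewrite -/x.
  have xj i : 0 <= x ^+ i <= 1 by rewrite exprn_ge0 // exprn_ile1.
  have xx : x ^+ j * x ^+ (k - j) = g by rewrite -exprD subnKC // ltnW.
  have := hfac _ _ (xj j) (xj (k - j)%N); rewrite xx => /(_ gI) H.
  apply/andP; split.
    have gw1 i : 0 <= 1 - (part_weight r (x ^+ i))^-1 <= 1.
      have h1 : 1 <= part_weight r (x ^+ i).
        rewrite /part_weight big_ord_recl expr0 lerDl; apply: sumr_ge0 => m _.
        by rewrite !exprn_ge0.
      rewrite subr_ge0 invf_le1 ?h1 ?gerBl ?invr_ge0 ?(lt_le_trans _ h1) //.
      exact: (le_trans _ h1).
    have /andP[a0 a1] := gw1 j; have /andP[b0 b1] := gw1 (k - j)%N.
    have /andP[c2 c1] : 0 <= 1 - penalty R <= 1 by rewrite /penalty; lra.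
    by rewrite subr_ge0 mulr_ile1 ?mulr_ge0 ?mulr_ile1.
  apply: (le_trans H).
  rewrite (_ : - ka + _ = - l + (be * (x ^+ j + x ^+ (k - j) - s0) - ga * (g - 3 / 10))); last first.
    by rewrite /ka; ring.
  rewrite expRD; apply: (@le_trans _ _ (c * expR (be * (x ^+ j + x ^+ (k - j) - s0) - ga * (g - 3 / 10)))).
    by rewrite ler_wpM2l // -addrA; exact: expR_ge1Dx.
  by rewrite ler_wpM2r ?expR_ge0.
rewrite -expR_sum ler_expR big_split /= -mulr_sumr.
have -> : \sum_(1 <= j < k | (j.*2 < k)%N) - ka = - ka * \sum_(1 <= j < k | (j.*2 < k)%N) 1.
  by rewrite mulr_sumr; apply: eq_bigr => j _; rewrite mulr1.
(* The pairs are disjoint, so the left side is at most the geometric sum of the [x ^+ j] with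
   [0 < j < k]. *)
have s1 : \sum_(1 <= j < k | (j.*2 < k)%N) (x ^+ j + x ^+ (k - j)) <= (1 - g) / t.
  apply: le_trans (sum_pairs_le k (fun j => exprn_ge0 j x0)) _.
  have /andP[_ x11] := expRN_bounds t0; rewrite -/x in x11.
  rewrite -(prednK k0) geom_sum ?lt_eqF //.
  have /andP[_ ra] := expRN_ratio t0; rewrite -/x in ra.
  apply: ler_pM => //.
  - by rewrite subr_ge0 exprn_ile1.
  - by rewrite divr_ge0 // subr_ge0.
  by rewrite lerD2l lerN2 -xk ler_wiXn2l // leq_pred.
(* The 1 missing from [k / 2] costs [ka <= 1], which is the 1 in [expR (1 - Sp / t)]. *)
have s2 := pair_number_ge R k.
set m := \sum_(1 <= j < k | _) 1 in s2 *.
have h1 : ka * (k%:R / 2 - 1) <= ka * m by rewrite ler_wpM2l.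
have h2 := ler_wpM2l be0 s1.
apply: (@le_trans _ _ (- (ka * (k%:R / 2 - 1)) + be * ((1 - g) / t))).
  by rewrite mulNr lerD // lerN2.
have -> : k%:R = u / t by rewrite /u mulrAC divff ?mul1r // gt_eqF.
have -> : - (ka * (u / t / 2 - 1)) + be * ((1 - g) / t) = ka - (ka * (u / 2) - be * (1 - g)) / t.
  by field; rewrite gt_eqF.
by apply: lerB => //; rewrite ler_wpM2r // invr_ge0 ltW.
Qed.

Lemma lt1_le_expRN (R : realType) (M : nat) (y : R) : 0 <= y < 1 ->
  1 - y <= expR (- log_sum M y).
Proof.
move=> yI; have /andP[_ y1] := yI.
have y0 : 0 < 1 - y by rewrite subr_gt0.
rewrite -[leLHS](@lnK R) ?posrE // ler_expR lerNr; exact: log_sum_le.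
Qed.

Lemma ln_10_3_bounds (R : realType) :
  exists L : R, expR (- L) = 3 / 10 /\ 1203 / 1000 <= L <= 1205 / 1000.
Proof.
exists (- ln (3 / 10)); rewrite opprK lnK ?posrE ?divr_gt0 //; split=> //.
(* [3 / 10 = (3 / 4)^3 * (8 / 9) * (4 / 5)]: the series converge fast at [1 / 4], [1 / 9] and
   [1 / 5]. *)
have E : - ln (3 / 10) = 3 * (- ln (1 - 1 / 4)) + (- ln (1 - 1 / 9)) + (- ln (1 - 1 / 5)) :> R.
  rewrite (_ : 3 / 10 = (1 - 1 / 4) * (1 - 1 / 4) * (1 - 1 / 4) * (1 - 1 / 9) * (1 - 1 / 5) :> R); last by field.
  have h4 : 0 < 1 - 1 / 4 :> R by lra.
  have h9 : 0 < 1 - 1 / 9 :> R by lra.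
  have h5 : 0 < 1 - 1 / 5 :> R by lra.
  by rewrite !lnM ?posrE ?mulr_gt0 //; ring.
have I4 : 0 <= (1 / 4 : R) < 1 by apply/andP; split; lra.
have I9 : 0 <= (1 / 9 : R) < 1 by apply/andP; split; lra.
have I5 : 0 <= (1 / 5 : R) < 1 by apply/andP; split; lra.
have := log_sum_le 7 I4; have := log_sum_ge 7 I4.
have := log_sum_le 3 I9; have := log_sum_ge 3 I9.
have := log_sum_le 5 I5; have := log_sum_ge 5 I5.
rewrite E /log_sum !big_ord_recr !big_ord0 /=.
set a := ln _; set b := ln _; set c := ln _.
rewrite (_ : (1 - 1 / 4)^-1 = 4 / 3); last by field.
rewrite (_ : (1 - 1 / 9)^-1 = 9 / 8); last by field.
rewrite (_ : (1 - 1 / 5)^-1 = 5 / 4); last by field.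
by clear => *; apply/andP; split; lra.
Qed.

Lemma part_weight1E (R : realFieldType) (a : R) : part_weight 1 a = 1 + a.
Proof. by rewrite /part_weight !big_ord_recr big_ord0 /= add0r expr0 expr1. Qed.

Lemma part_weight2E (R : realFieldType) (a : R) : part_weight 2 a = 1 + a + a ^+ 2.
Proof. by rewrite /part_weight !big_ord_recr big_ord0 /= add0r expr0 expr1. Qed.

(** The upper bound is [(1 - a) * (1 - b) >= 0], the lower one [(a + b)^2 >= 4 * a * b]. *)
Lemma sum_bounds (R : realFieldType) (a b : R) : 0 <= a <= 1 -> 0 <= b <= 1 ->
  27 / 100 <= a * b <= 33 / 100 -> 103 / 100 <= a + b <= 133 / 100.
Proof.
move=> /andP[a0 a1] /andP[b0 b1] /andP[g1 g2].
have h1 : 0 <= (1 - a) * (1 - b) by rewrite mulr_ge0 // subr_ge0.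
have h2 := sqr_ge0 (a - b).
apply/andP; split; last by lra.
rewrite leNgt; apply/negP => ab.
have : (a + b) * (a + b) <= 103 / 100 * (103 / 100).
  by apply: ler_pM; rewrite ?addr_ge0 // ltW.
move: h2; rewrite expr2; lra.
Qed.

(** By symmetry, clearing denominators leaves polynomials in [s = a + b] and [g = a * b] on a
    rectangle. The constant 0.881 lies slightly above the value 0.879 of the factor at the point of
    tangency, to make room for the curvature. *)
Lemma pair_factor_1 (R : realType) (a b : R) : 0 <= a <= 1 -> 0 <= b <= 1 ->
  27 / 100 <= a * b <= 33 / 100 ->
  1 - (1 - penalty R) * (1 - (part_weight 1 a)^-1) * (1 - (part_weight 1 b)^-1) <=
  881 / 1000 * (1 + 56 / 1000 * (a + b - 116 / 100) - 4 / 10 * (a * b - 3 / 10)).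
Proof.
move=> aI bI gI; have sI := sum_bounds aI bI gI.
have /andP[a0 _] := aI; have /andP[b0 _] := bI.
have h : 0 < (1 + a) * (1 + b) by rewrite mulr_gt0 // ltr_pwDl.
rewrite !part_weight1E -(ler_pM2r h) /penalty.
have -> : (1 - (1 - 1 / 200) * (1 - (1 + a)^-1) * (1 - (1 + b)^-1)) * ((1 + a) * (1 + b)) =
    (1 + a) * (1 + b) - 199 / 200 * (a * b).
  by field; rewrite !gt_eqF // ltr_pwDl.
have -> : (1 + a) * (1 + b) = 1 + (a + b) + a * b by ring.
move: sI gI; set s := a + b; set g := a * b; clear => /andP[s1 s2] /andP[g1 g2].
have h1 : 0 <= (g - 27 / 100) * (33 / 100 - g) by rewrite mulr_ge0 ?subr_ge0.
have h3 : 0 <= (g - 27 / 100) * (s - 103 / 100) by rewrite mulr_ge0 ?subr_ge0.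
have h4 : 0 <= (g - 27 / 100) * (133 / 100 - s) by rewrite mulr_ge0 ?subr_ge0.
have h5 : 0 <= (33 / 100 - g) * (s - 103 / 100) by rewrite mulr_ge0 ?subr_ge0.
have h6 : 0 <= (33 / 100 - g) * (133 / 100 - s) by rewrite mulr_ge0 ?subr_ge0.
have h7 := sqr_ge0 (s - 116 / 100).
lra.
Qed.

Lemma pair_factor_2 (R : realType) (a b : R) : 0 <= a <= 1 -> 0 <= b <= 1 ->
  27 / 100 <= a * b <= 33 / 100 ->
  1 - (1 - penalty R) * (1 - (part_weight 2 a)^-1) * (1 - (part_weight 2 b)^-1) <=
  803 / 1000 * (1 + 148 / 1000 * (a + b - 116 / 100) - 88 / 100 * (a * b - 3 / 10)).
Proof.
move=> aI bI gI; have sI := sum_bounds aI bI gI.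
have /andP[a0 _] := aI; have /andP[b0 _] := bI.
have w0 (z : R) : 0 <= z -> 0 < 1 + z + z ^+ 2.
  by move=> z0; rewrite -addrA ltr_pwDl // addr_ge0 // sqr_ge0.
have h : 0 < (1 + a + a ^+ 2) * (1 + b + b ^+ 2) by rewrite mulr_gt0 // w0.
rewrite !part_weight2E -(ler_pM2r h) /penalty.
have -> : (1 - (1 - 1 / 200) * (1 - (1 + a + a ^+ 2)^-1) * (1 - (1 + b + b ^+ 2)^-1)) *
     ((1 + a + a ^+ 2) * (1 + b + b ^+ 2)) =
    (1 + a + a ^+ 2) * (1 + b + b ^+ 2) - 199 / 200 * (a * b * (1 + a * b + (a + b))).
  by field; rewrite !gt_eqF // w0.
have -> : (1 + a + a ^+ 2) * (1 + b + b ^+ 2) =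
    1 + (a + b) + (a + b) ^+ 2 - a * b + a * b * (a + b) + (a * b) ^+ 2 by ring.
move: sI gI; set s := a + b; set g := a * b; clear => /andP[s1 s2] /andP[g1 g2].
(* The difference of both sides has positive coefficients in the Bernstein
   basis of bidegree (3, 3) on the rectangle. *)
have B i j : 0 <= (g - 27 / 100) ^+ i * (33 / 100 - g) ^+ (3 - i) *
    ((s - 103 / 100) ^+ j * (133 / 100 - s) ^+ (3 - j)).
  by rewrite !mulr_ge0 ?exprn_ge0 ?subr_ge0.
have := B 0 0; have := B 0 1; have := B 0 2; have := B 0 3.
have := B 1 0; have := B 1 1; have := B 1 2; have := B 1 3.
have := B 2 0; have := B 2 1; have := B 2 2; have := B 2 3.
have := B 3 0; have := B 3 1; have := B 3 2; have := B 3 3.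
rewrite /= !expr0 !expr1 ?mul1r ?mulr1; clear -R; lra.
Qed.

Lemma pair_prod_le_1 (R : realType) (L : R) : expR (- L) = 3 / 10 ->
  1203 / 1000 <= L <= 1205 / 1000 ->
  forall (t : R) (k : nat), 0 < t -> (0 < k)%N ->
    L - 7 / 100 <= t * k%:R <= L + 7 / 100 ->
    pair_prod 1 k t <= expR (1 - (74 / 1000) / t).
Proof.
move=> hL /andP[L1 L2].
(* [119 / 1000 = 1 - 881 / 1000]; three terms of the logarithm give
   [881 / 1000 <= exp(- 126 / 1000)]. *)
have I : 0 <= (119 / 1000 : R) < 1 by apply/andP; split; lra.
apply: (@pair_prod_le R 1 (881 / 1000) (126 / 1000) (56 / 1000) (4 / 10) (116 / 100) (74 / 1000) L _ _ hL (@pair_factor_1 R)).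
- lra.
- apply: le_trans (le_trans _ (lt1_le_expRN 3 I)) _; first by lra.
  by rewrite /log_sum !big_ord_recr big_ord0 /= ler_expR; lra.
- lra.
move=> u g /andP[u1 u2] /andP[g1 g2] g3 ka.
have kaE : ka = 126 / 1000 + 56 / 1000 * (116 / 100) + 4 / 10 * (g - 3 / 10) by [].
clear hL I; split; first by rewrite kaE; move: g1 g2; clear=> *; apply/andP; split; lra.
have u0 : 0 <= u by move: u1 L1; clear; lra.
have h1 := ler_wpM2l u0 g3.
have h2 : 0 <= (u - L + 7 / 100) * (L + 7 / 100 - u).
  by apply: mulr_ge0; move: u1 u2; clear; lra.
rewrite kaE; nra.
Qed.

Lemma pair_prod_le_2 (R : realType) (L : R) : expR (- L) = 3 / 10 ->
  1203 / 1000 <= L <= 1205 / 1000 ->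
  forall (t : R) (k : nat), 0 < t -> (0 < k)%N ->
    L - 7 / 100 <= t * k%:R <= L + 7 / 100 ->
    pair_prod 2 k t <= expR (1 - (129 / 1000) / t).
Proof.
move=> hL /andP[L1 L2].
have I : 0 <= (197 / 1000 : R) < 1 by apply/andP; split; lra.
apply: (@pair_prod_le R 2 (803 / 1000) (219 / 1000) (148 / 1000) (88 / 100) (116 / 100) (129 / 1000) L _ _ hL (@pair_factor_2 R)).
- lra.
- apply: le_trans (le_trans _ (lt1_le_expRN 4 I)) _; first by lra.
  by rewrite /log_sum !big_ord_recr big_ord0 /= ler_expR; lra.
- lra.
move=> u g /andP[u1 u2] /andP[g1 g2] g3 ka.
have kaE : ka = 219 / 1000 + 148 / 1000 * (116 / 100) + 88 / 100 * (g - 3 / 10) by [].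
clear hL I; split; first by rewrite kaE; move: g1 g2; clear=> *; apply/andP; split; lra.
have u0 : 0 <= u by move: u1 L1; clear; lra.
have h1 := ler_wpM2l u0 g3.
have h2 : 0 <= (u - L + 7 / 100) * (L + 7 / 100 - u).
  by apply: mulr_ge0; move: u1 u2; clear; lra.
rewrite kaE; nra.
Qed.

(** For [j <= w] one has [exp(- t j) >= 1 - t w >= 86 / 100], so each of the [w] factors is at most
    [om]. The defect of [w] against [(14 / 100) / t], at most 2, is paid by the summand 2, since
    [la <= 1]. *)
Lemma small_prod_le (R : realType) (r : nat) (om la S : R) :
  (forall y, 86 / 100 <= y -> penalty R + (1 - penalty R) / part_weight r y <= om) ->
  om <= expR (- la) -> 0 <= la <= 1 -> S <= 14 / 100 * la ->
  forall (t : R) (w : nat), 0 < t -> 14 / 100 - 2 * t <= t * w%:R <= 14 / 100 ->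
    small_prod r w t <= expR (2 - S / t).
Proof.
move=> hom hla /andP[la0 la1] hS t w t0 /andP[w1 w2].
have x0 : 0 <= expR (- t) by exact: expR_ge0.
have x1 : expR (- t) <= 1 by rewrite expR_le1 oppr_le0 ltW.
apply: (@le_trans _ _ (\prod_(1 <= j < w.+1) expR (- la))).
  rewrite /small_prod !big_nat; apply: ler_prod => j /andP[_ jw].
  have xj : 86 / 100 <= expR (- t) ^+ j.
    apply: (@le_trans _ _ (expR (- t) ^+ w)); last by rewrite ler_wiXn2l.
    by rewrite -expRM_natr mulNr; have := expR_ge1Dx (- (t * w%:R)); lra.
  apply/andP; split; last exact: le_trans (hom _ xj) hla.
  have l0 : 0 <= penalty R <= 1 by rewrite /penalty; apply/andP; split; lra.
  have /andP[l1 l2] := l0.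
  rewrite addr_ge0 // divr_ge0 ?subr_ge0 //; apply: sumr_ge0 => m _.
  by rewrite !exprn_ge0.
rewrite prodr_const_nat subn1 /= -expRM_natr ler_expR.
rewrite -(ler_pM2l t0) mulrBr [t * (S / t)]mulrC divfK ?gt_eqF //.
have := ler_wpM2l la0 w1; have := ler_wpM2r (ltW t0) la1; lra.
Qed.

Lemma small_prod_le_1 (R : realType) (t : R) (w : nat) : 0 < t ->
  14 / 100 - 2 * t <= t * w%:R <= 14 / 100 ->
  small_prod 1 w t <= expR (2 - (74 / 1000) / t).
Proof.
have I : 0 <= (46 / 100 : R) < 1 by apply/andP; split; lra.
apply: (@small_prod_le R 1 (54 / 100) (59 / 100)).
- move=> y y86; have y0 : 0 < 1 + y by lra.
  by rewrite part_weight1E /penalty -lerBrDl ler_pdivrMr //; lra.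
- apply: le_trans (le_trans _ (lt1_le_expRN 3 I)) _; first by lra.
  by rewrite /log_sum !big_ord_recr big_ord0 /= ler_expR; lra.
- by apply/andP; split; lra.
- lra.
Qed.

Lemma small_prod_le_2 (R : realType) (t : R) (w : nat) : 0 < t ->
  14 / 100 - 2 * t <= t * w%:R <= 14 / 100 ->
  small_prod 2 w t <= expR (2 - (129 / 1000) / t).
Proof.
have I : 0 <= (612 / 1000 : R) < 1 by apply/andP; split; lra.
apply: (@small_prod_le R 2 (388 / 1000) (94 / 100)).
- move=> y y86; have y2 : 86 / 100 * (86 / 100) <= y ^+ 2.
    by rewrite expr2; apply: ler_pM; lra.
  have y0 : 0 < 1 + y + y ^+ 2 by lra.
  by rewrite part_weight2E /penalty -lerBrDl ler_pdivrMr //; lra.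
- apply: le_trans (le_trans _ (lt1_le_expRN 8 I)) _; first by lra.
  by rewrite /log_sum !big_ord_recr big_ord0 /= ler_expR; lra.
- by apply/andP; split; lra.
- lra.
Qed.

(** * Comparison of the exponents *)

(** [B] is the constant of [Q]; the generating function behind [num_sets] enters only through the
    first hypothesis. There [tau = th * Num.sqrt B] makes the main terms agree, and the margin
    [del / (2 * tau)] covers the error in the lower bound for [Q], scaled by [th <= 1]. *)
Lemma num_sets_le_powR (R : realType) (r : nat) (B th del : R) (Q r_ : nat -> nat) :
  (forall L : R, expR (- L) = 3 / 10 -> 1203 / 1000 <= L <= 1205 / 1000 ->
    let tau := th * Num.sqrt B in
    exists N : nat, forall n : nat, (N <= n)%N ->
      (num_sets r n)%:R <= expR ((2 * tau - del / (2 * tau)) * Num.sqrt n%:R)) ->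
  0 < B -> 0 < del -> 0 < th <= 1 -> restricted_gf_asymp B r_ ->
  (forall n m, (0 < m <= n)%N ->
    (#|[set v : {ffun 'I_n -> 'I_(r_ n).+1} | mult_sum v == m]| <= Q n)%N) ->
  exists N : nat, forall n : nat, (N <= n)%N -> (num_sets r n)%:R <= (Q n)%:R `^ th.
Proof.
move=> upper B0 del0 /andP[th0 th1] asym hQ.
have [L [hL LI]] := ln_10_3_bounds R.
have [N1 HN1] := upper L hL LI.
set tau := th * Num.sqrt B in HN1.
have tau0 : 0 < tau by rewrite mulr_gt0 ?sqrtr_gt0.
have e0 : 0 < del / (2 * tau) by rewrite divr_gt0 // mulr_gt0.
have [N2 HN2] := partition_lower B0 asym hQ e0.
exists (maxn N1 N2) => n; rewrite geq_max => /andP[n1 n2].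
apply: le_trans (HN1 n n1) _.
apply: le_trans (_ : expR ((2 * Num.sqrt B - del / (2 * tau)) * Num.sqrt n%:R) `^ th <= _); last first.
  by apply: ge0_ler_powR; rewrite ?nnegrE ?expR_ge0 ?(ltW th0) //; exact: HN2.
rewrite -expRM ler_expR.
have h : th * (del / (2 * tau)) * Num.sqrt n%:R <= del / (2 * tau) * Num.sqrt n%:R.
  by rewrite ler_wpM2r ?sqrtr_ge0 // ler_piMl // ltW.
rewrite -subr_ge0 in h; rewrite -subr_ge0.
rewrite (_ : _ - _ = del / (2 * tau) * Num.sqrt n%:R - th * (del / (2 * tau)) * Num.sqrt n%:R) //.
by rewrite /tau; ring.
Qed.

Lemma qhat_le_powR (R : realType) : exists N : nat, forall n : nat, (N <= n)%N ->
  (qhat n)%:R <= ((q n)%:R : R) `^ (955%:R / 1000%:R).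
Proof.
have [Z [/andP[Z1 Z2] hZ approx]] := zeta2_exists R.
have zeta : is_zeta2 Z by split=> //; lra.
have asym := restricted_gf_asymp_fixed 1 zeta.
have B0 : 0 < Z * (1 / 2) by lra.
have del0 : 0 < 1 / 1000 :> R by lra.
have thI : 0 < (955 / 1000 : R) <= 1 by apply/andP; split; lra.
have [|N HN] := num_sets_le_powR (r := 1) (Q := q) _ B0 del0 thI asym card_mult_sum_q; last first.
  exists N => n /HN; apply: le_trans.
  by rewrite ler_nat qhat_le.
move=> L hL LI tau; have /andP[L1 L2] := LI.
have tau2 : tau ^+ 2 = (955 / 1000) ^+ 2 * (Z * (1 / 2)).
  by rewrite exprMn sqr_sqrtr ?ltW.
have /andP[/ltW th0 _] := thI; have tau0 : 0 <= tau := mulr_ge0 th0 (sqrtr_ge0 _).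
clearbody tau.
have tau45 : 4 / 5 <= tau.
  rewrite leNgt; apply/negP => tau45.
  have : tau * tau <= 4 / 5 * (4 / 5) by exact: (ler_pM tau0 tau0 (ltW tau45) (ltW tau45)).
  by rewrite -expr2 tau2; move: Z1; clear; lra.
(* The critical inequality: at [Z = 33 / 20] the left side is about 0.0736. *)
have S74 : Z * (1 / 2) - tau ^+ 2 + 1 / 1000 <= 74 / 1000.
  by rewrite tau2; move: Z2; clear; lra.
apply: (num_sets_upper (L := L) tau45 del0 asym) => [t k t0 k0 tk|t w t0 tw||||].
- apply: le_trans (pair_prod_le_1 hL LI t0 k0 tk) _.
  by rewrite ler_expR lerD2l lerN2; apply: ler_wpM2r; [rewrite invr_ge0 ltW|].
- apply: le_trans (small_prod_le_1 t0 tw) _.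
  by rewrite ler_expR lerD2l lerN2; apply: ler_wpM2r; [rewrite invr_ge0 ltW|].
- by rewrite tau2; move: Z1 Z2; clear; lra.
- by move: L1 L2; clear=> *; apply/andP; split; lra.
- by rewrite tau2; move: Z1; clear; lra.
- by rewrite tau2; move: Z1 L2; clear; lra.
Qed.

Lemma phat_le_powR (R : realType) : exists N : nat, forall n : nat, (N <= n)%N ->
  (phat n)%:R <= ((p n)%:R : R) `^ (768%:R / 1000%:R).
Proof.
have [Z [/andP[Z1 Z2] hZ approx]] := zeta2_exists R.
have zeta : is_zeta2 Z by split=> //; lra.
have asym := restricted_gf_asymp_fixed 2 zeta.
have B0 : 0 < Z by lra.
have del0 : 0 < 1 / 1000 :> R by lra.
have thI : 0 < (768 / 1000 : R) <= 1 by apply/andP; split; lra.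
(* Two generating functions meet here: multiplicities at most 2, with constant [2 * Z / 3], for the
   sets, and at most [n], with constant [Z], for [p n]. *)
have [|N HN] := num_sets_le_powR (r := 2) (Q := p) _ B0 del0 thI (restricted_gf_asymp_id zeta)
  (fun n m => @card_mult_sum_p n n m); last first.
  exists N => n /HN; apply: le_trans.
  by rewrite ler_nat phat_le.
move=> L hL LI tau; have /andP[L1 L2] := LI.
have tau2 : tau ^+ 2 = (768 / 1000) ^+ 2 * Z.
  by rewrite exprMn sqr_sqrtr ?ltW.
have /andP[/ltW th0 _] := thI; have tau0 : 0 <= tau := mulr_ge0 th0 (sqrtr_ge0 _).
clearbody tau.
have tau45 : 4 / 5 <= tau.
  rewrite leNgt; apply/negP => tau45.
  have : tau * tau <= 4 / 5 * (4 / 5) by exact: (ler_pM tau0 tau0 (ltW tau45) (ltW tau45)).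
  by rewrite -expr2 tau2; move: Z1; clear; lra.
(* At [Z = 33 / 20] the left side is about 0.1278. *)
have S129 : Z * (2 / 3) - tau ^+ 2 + 1 / 1000 <= 129 / 1000.
  by rewrite tau2; move: Z2; clear; lra.
apply: (num_sets_upper (L := L) tau45 del0 asym) => [t k t0 k0 tk|t w t0 tw||||].
- apply: le_trans (pair_prod_le_2 hL LI t0 k0 tk) _.
  by rewrite ler_expR lerD2l lerN2; apply: ler_wpM2r; [rewrite invr_ge0 ltW|].
- apply: le_trans (small_prod_le_2 t0 tw) _.
  by rewrite ler_expR lerD2l lerN2; apply: ler_wpM2r; [rewrite invr_ge0 ltW|].
- by rewrite tau2; move: Z1 Z2; clear; lra.
- by move: L1 L2; clear=> *; apply/andP; split; lra.
- by rewrite tau2; move: Z1; clear; lra.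
- by rewrite tau2; move: Z1 L2; clear; lra.
Qed.

Theorem theorem2 (R : realType) :
  exists N : nat, forall n : nat, (N <= n)%N ->
    ((qhat n)%:R : R) <= (q n)%:R `^ (955%:R / 1000%:R) /\
    ((phat n)%:R : R) <= (p n)%:R `^ (768%:R / 1000%:R).
Proof.
have [N1 H1] := qhat_le_powR R; have [N2 H2] := phat_le_powR R.
exists (maxn N1 N2) => n; rewrite geq_max => /andP[n1 n2].
by split; [exact: H1|exact: H2].
Qed.
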